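(* Let $x:[t_0,+\infty)\to\mathcal H$ be a solution trajectory (strong global solution) of the system $$\ddot x(t)+\alpha(t)\dot x(t)+\beta(t)\frac{d}{dt}T_{\lambda(t),\gamma(t)}(x(t))+b(t)T_{\lambda(t),\gamma(t)}(x(t))=0,$$ where all data satisfy the standing assumptions listed in the context. Let $a,m,c:[t_0,+\infty)\to(0,+\infty)$ be continuous and differentiable functions such that, for almost every $t\ge t_0$, - $m(t)\dot a(t)+a(t)\big(a(t)+\dot m(t)-m(t)\alpha(t)\big)+c(t)=0$; - $\mathcal W_v(t)>0$ and $\mathcal W_T(t)>0$; - $a(t)\dot a(t)+\tfrac12\dot c(t)\le 0$; and $\inf_{t\ge t_0}c(t)>0$ (with $\mathcal W_v,\mathcal W_T$ defined in the context). Then the following hold as $t\to+\infty$. **(1)** If $\sup_{t\ge t_0}a(t)<+\infty$ and $\sup_{t\ge t_0}\frac{m(t)\beta(t)}{\lambda(t)}<+\infty$, then (i) $\|T_{\lambda(t),\gamma(t)}(x(t))\|=\mathcal O\big(\frac1{\lambda(t)}\big)$; (ii) $\|\dot x(t)\|=\mathcal O\big(\frac1{m(t)}\big)$. **(2)** If, in addition to the hypotheses of (1), there are constants $\underline m',\bar m'$ with $0<\underline m'\le\dot m(t)\le\bar m'$, and $m(t)\ge\dot m(t)$, $\inf_{t\ge t_0}\gamma(t)>0$, and $\frac{|\dot\gamma(t)|}{\gamma(t)}=\mathcal O\big(\frac{\dot m(t)}{m(t)}\big)$, $\frac{|\dot\lambda(t)|}{\lambda(t)}=\mathcal O\big(\frac{\dot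 m(t)}{m(t)}\big)$, then (iii) $\big\|\frac{d}{dt}T_{\lambda(t),\gamma(t)}(x(t))\big\|=\mathcal O\big(\frac{\dot m(t)}{m(t)\lambda(t)}\big)$. **(3)** If, in addition to the hypotheses of (1) and (2), there are constants $C_b,C_\lambda,C_v,C_T>0$ such that - $\alpha(t)=\mathcal O\big(\frac{\dot m(t)}{m(t)}\big)$, $\beta(t)=\mathcal O\big(\frac{m(t)}{\dot m(t)}\big)$, $b(t)=\mathcal O(1)$, $b^2(t)\le C_b\frac{\dot m(t)\mathcal W_T(t)}{m^3(t)}$; - $\lambda(t)\ge C_\lambda m^2(t)$; - $\mathcal W_v(t)\ge C_v m(t)\dot m(t)$ and $\mathcal W_T(t)\ge C_T m^2(t)\dot m(t)$; - $\liminf_{t\to+\infty}\frac{m(t)\mathcal W_T(t)}{\dot m(t)\lambda^2(t)}>0$, then (iv) $\|\ddot x(t)\|=\mathcal O\big(\frac{\dot m(t)}{m^2(t)}\big)$; (v) $\|\dot x(t)\|=o\big(\frac1{m(t)}\big)$; (vi) $\|T_{\lambda(t),\gamma(t)}(x(t))\|=o\big(\frac1{\lambda(t)}\big)$; (vii) $\|A_{\gamma(t)}(x(t)-\gamma(t)Bx(t))+Bx(t)\|=o\big(\frac1{\gamma(t)}\big)$; (viii) $\Big\|\frac{d}{dt}\big(A_{\gamma(t)}(x(t)-\gamma(t)Bx(t))+Bx(t)\big)\Big\|=\mathcal O\Big(\frac{\dot m(t)}{m(t)\gamma(t)}\Big)+o\Big(\frac{\lambda(t)\,\big|\frac{d}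{dt}\big(\frac{\gamma(t)}{\lambda(t)}\big)\big|}{\gamma^2(t)}\Big)$.
   Context: $\mathcal H$ is a real Hilbert space with inner product $\langle\cdot,\cdot\rangle$ and norm $\|\cdot\|$; $t_0\in\mathbb R$ is a fixed initial time. A set-valued operator $A:\mathcal H\to2^{\mathcal H}$ is $\rho$-comonotone ($\rho\in\mathbb R$) if $\langle x-y,u-v\rangle\ge\rho\|u-v\|^2$ for all $(x,u),(y,v)$ in its graph; it is maximal $\rho$-comonotone if moreover no $\rho$-comonotone operator has a graph properly containing that of $A$. A map $B:\mathcal H\to\mathcal H$ is $\nu$-cocoercive if $\langle Bx-By,x-y\rangle\ge\nu\|Bx-By\|^2$ for all $x,y$. $\operatorname{zer}(A+B)=\{x:0\in(A+B)(x)\}$. Resolvent: $J_{\gamma A}=(\operatorname{Id}+\gamma A)^{-1}$. Yosida approximation: $A_\gamma=\frac1\gamma(\operatorname{Id}-J_{\gamma A})$. Splitting operator: $T_{\lambda,\gamma}=\frac1\lambda\big(\operatorname{Id}-J_{\gamma A}\circ(\operatorname{Id}-\gamma B)\big)$. Standing assumptions: - $A$ is maximal $\rho$-comonotone, $B$ is $\nu$-cocoercive with $\nu>0$; $\lambda,\gamma,\delta,\theta,\phi,\psi:[t_0,+\infty)\to\mathbb R$ are continuously differentiable with $\lambda(t)>0$, $\delta(t)>0$, $\theta(t)\in[0,1]$, $\phi(t)\ge0$, $\psi(t)\ge0$, $\gamma(t)\in[\underline\gamma,\bar\gamma]\subset(\max\{0,-2\rho\},2\nu)$ for all $t\ge t_0$;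 and $\inf_{t\ge t_0}\Lambda(t)>0$, where $\Lambda(t)=\lambda(t)\frac{4\nu(\rho+\gamma(t))-\gamma^2(t)}{4\gamma(t)(\nu+\rho)}$. - $\operatorname{zer}(A+B)\ne\emptyset$. - With $\Gamma(t)=\theta(t)\phi(t)+(1-\theta(t))\psi(t)<1$, the coefficients are $$\alpha=\frac{\delta-\dot\Gamma}{1-\Gamma}-\frac{\dot\delta}{\delta},\qquad \beta=\frac{\lambda\theta}{1-\Gamma},\qquad b=\frac{\frac{d}{dt}(\lambda\theta)-\lambda\theta\,\frac{\dot\delta}{\delta}}{1-\Gamma},$$ and they satisfy $\alpha(t)>0$, $b(t)\ge0$, $\beta(t)>0$ for all $t\ge t_0$; $\alpha,b$ are locally integrable and $\beta$ is locally absolutely continuous. A strong global solution of the system is a function $x:[t_0,+\infty)\to\mathcal H$ such that $x,\dot x$ are continuous and absolutely continuous on each bounded interval $[t_0,T]$ and the equation holds for almost every $t\ge t_0$. Here $\frac{d}{dt}T_{\lambda(t),\gamma(t)}(x(t))$ is the derivative of $t\mapsto T_{\lambda(t),\gamma(t)}(x(t))$; statements about $\ddot x$ and about such derivatives are understood for almost every $t$. Auxiliary functions (given $a,m,c$): $\mathcal K(t)=b(t)-\dot\beta(t)-\alpha(t)\beta(t)$; $\mathcal Q_1(t)=a(t)\big(a(t)\beta(t)+m(t)\mathcal K(t)\big)+c(t)\beta(t)$; $\mathcal Q_2(t)=m(t)\big(a(t)\beta(t)+m(t)\mathcal K(t)\big)$; $\mathcal W_v(t)=-m(t)\big(a(t)+\dot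 m(t)-m(t)\alpha(t)\big)$; $\mathcal W_T(t)=\mathcal Q_1(t)\Lambda(t)-\frac{\mathcal Q_2^2(t)}{2\mathcal W_v(t)}$. *)

(* Defs.v *)
From HB Require Import structures.
From mathcomp Require Import all_boot all_order all_algebra.
From mathcomp Require Import all_classical all_reals all_analysis.

Set Implicit Arguments.
Unset Strict Implicit.
Unset Printing Implicit Defensive.

Import Order.TTheory GRing.Theory Num.Theory.
Import numFieldNormedType.Exports.

Local Open Scope classical_set_scope.
Local Open Scope ring_scope.

(* A real Hilbert space is a complete normed module whose norm is the one
   induced by the inner product [ip]. *)
Definition inner_product (R : realType) (H : completeNormedModType R)
    (ip : H -> H -> R) : Prop :=
  [/\ forall x y, ip x y = ip y x,
      forall k x y z, ip (k *: x + y) z = k * ip x z + ip y z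
    & forall x, ip x x = `|x| ^+ 2].

(* Set-valued operators on [H] are functions [H -> set H]. *)
Section Operators.
Context {R : realType} {H : completeNormedModType R} (ip : H -> H -> R).
Implicit Types (A : H -> set H) (B : H -> H).

Definition comonotone (rho : R) A : Prop :=
  forall x y u v, A x u -> A y v -> rho * `|u - v| ^+ 2 <= ip (x - y) (u - v).

Definition maximal_comonotone (rho : R) A : Prop :=
  comonotone rho A /\
  forall A', comonotone rho A' -> (forall x, A x `<=` A' x) -> A' = A.

Definition cocoercive (nu : R) B : Prop :=
  forall x y, nu * `|B x - B y| ^+ 2 <= ip (B x - B y) (x - y).

Definition op_add A B : H -> set H := fun x => [set u + B x | u in A x].

Definition op_inv A : H -> set H := fun x => [set y | A y x].

Definition op_Id_plus (g : R) A : H -> set H :=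
  fun x => [set x + g *: u | u in A x].

Definition zer A : set H := [set x | A x 0].

(* The resolvent as a map: the element of the set [(Id + g A)^-1 x], which is a
   singleton when A is maximal rho-comonotone and g > max(0, - 2 rho).  The
   default value 0 is only used if that set is empty. *)
Definition resolvent (g : R) A (x : H) : H := xget 0 (op_inv (op_Id_plus g A) x).

Definition yosida (g : R) A (x : H) : H := g^-1 *: (x - resolvent g A x).

Definition splitting (l g : R) A B (x : H) : H :=
  l^-1 *: (x - resolvent g A (x - g *: B x)).

End Operators.

(* Functions on [t0, +oo[ are represented by functions on R of which only the
   values on [t0, +oo[ matter. Accordingly the derivative is taken within
   [t0, +oo[; at t0 it is the right derivative. *)
Section Calculus.
Context {R : realType}.

Definition diff_quotient {V : normedModType R} (f : R -> V) (t s : R) : V :=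
  (s - t)^-1 *: (f s - f t).

Definition derivable_from {V : normedModType R} (t0 : R) (f : R -> V) (t : R) :
    Prop :=
  cvg (diff_quotient f t s @[s --> within `[t0, +oo[ t^']).

Definition deriv_from {V : normedModType R} (t0 : R) (f : R -> V) (t : R) : V :=
  lim (diff_quotient f t s @[s --> within `[t0, +oo[ t^']).

Definition differentiable_from {V : normedModType R} (t0 : R) (f : R -> V) :
    Prop :=
  forall t, t0 <= t -> derivable_from t0 f t.

Definition C1_from {V : normedModType R} (t0 : R) (f : R -> V) : Prop :=
  differentiable_from t0 f /\ {within `[t0, +oo[, continuous (deriv_from t0 f)}.

Definition absolutely_continuous_on {V : normedModType R} (p q : R)
    (f : R -> V) : Prop :=
  forall eps : R, 0 < eps -> exists2 delta : R, 0 < delta &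
    forall (n : nat) (u v : 'I_n -> R),
      (forall i, p <= u i /\ u i <= v i /\ v i <= q) ->
      trivIset setT (fun i => `]u i, v i[%classic) ->
      \sum_(i < n) (v i - u i) < delta ->
      \sum_(i < n) `|f (v i) - f (u i)| < eps.

Definition locally_ac_from {V : normedModType R} (t0 : R) (f : R -> V) : Prop :=
  forall T, absolutely_continuous_on t0 T f.

Definition locally_integrable_from (t0 : R) (f : R -> R) : Prop :=
  forall T, (@lebesgue_measure R).-integrable `[t0, T] (EFin \o f).

Definition ae_from (t0 : R) (P : R -> Prop) : Prop :=
  {ae @lebesgue_measure R, forall t, t0 <= t -> P t}.

(* The filter used for asymptotic statements about functions that are only
   meaningful almost everywhere: P holds at almost every large enough t. *)
Definition ae_pinfty : set_system R := [set P | exists t0, ae_from t0 P].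

Global Instance ae_pinfty_filter : Filter ae_pinfty.
Proof.
have FF := ae_filter_ringOfSetsType (@lebesgue_measure R).
split=> [|P Q [p Pp] [q Qq]|P Q PQ [p Pp]].
- by exists 0; apply: (@filterE _ _ FF).
- exists (Num.max p q); apply: (@filterS2 _ _ FF _ _ _ _ Pp Qq) => t Pt Qt.
  by rewrite ge_max => /andP[/Pt ? /Qt ?].
- by exists p; apply: (@filterS _ _ FF _ _ _ Pp) => t Pt /Pt /PQ.
Qed.

(* The Landau notations [=O_F] and [=o_F] need a canonical filter structure on F. *)
Canonical ae_pinfty_filter_on := FilterType ae_pinfty ae_pinfty_filter.

Canonical pinfty_filter_on :=
  FilterType (pinfty_nbhs R) _.

End Calculus.

Section Coefficients.
Context {R : realType}.
Variables (t0 rho nu : R) (lambda gamma delta theta phi psi : R -> R).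

Definition coef_Lambda (t : R) : R :=
  lambda t * ((4 * nu * (rho + gamma t) - gamma t ^+ 2) /
              (4 * gamma t * (nu + rho))).

Definition coef_Gamma (t : R) : R :=
  theta t * phi t + (1 - theta t) * psi t.

Definition coef_alpha (t : R) : R :=
  (delta t - deriv_from t0 coef_Gamma t) / (1 - coef_Gamma t)
  - deriv_from t0 delta t / delta t.

Definition coef_beta (t : R) : R := lambda t * theta t / (1 - coef_Gamma t).

Definition coef_b (t : R) : R :=
  (deriv_from t0 (fun s => lambda s * theta s) t
   - lambda t * theta t * (deriv_from t0 delta t / delta t))
  / (1 - coef_Gamma t).

End Coefficients.

Section Auxiliary.
Context {R : realType}.
Variables (t0 : R) (Lambda alpha beta b a m c : R -> R).

Definition aux_K (t : R) : R := b t - deriv_from t0 beta t - alpha t * beta t.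

Definition aux_Q1 (t : R) : R :=
  a t * (a t * beta t + m t * aux_K t) + c t * beta t.

Definition aux_Q2 (t : R) : R := m t * (a t * beta t + m t * aux_K t).

Definition aux_Wv (t : R) : R :=
  - m t * (a t + deriv_from t0 m t - m t * alpha t).

Definition aux_WT (t : R) : R :=
  aux_Q1 t * Lambda t - aux_Q2 t ^+ 2 / (2 * aux_Wv t).

End Auxiliary.

(* [Tx t] stands for T_{lambda(t), gamma(t)}(x(t)). The equation holding at t
   includes the existence of the derivatives occurring in it. *)
Definition strong_global_solution {R : realType} {H : completeNormedModType R}
    (t0 : R) (alpha beta b : R -> R) (Tx x : R -> H) : Prop :=
  let dx := deriv_from t0 x in
  [/\ differentiable_from t0 x,
      {within `[t0, +oo[, continuous x} /\ {within `[t0, +oo[, continuous dx},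
      locally_ac_from t0 x /\ locally_ac_from t0 dx
    & ae_from t0 (fun t =>
        [/\ derivable_from t0 dx t, derivable_from t0 Tx t
          & deriv_from t0 dx t + alpha t *: dx t
            + beta t *: deriv_from t0 Tx t + b t *: Tx t = 0])].

(* Main.v *)
Require Import Defs.
From mathcomp Require Import all_boot all_order all_algebra.
From mathcomp Require Import all_classical all_reals all_analysis.
From mathcomp Require Import ring lra.
Import Order.TTheory GRing.Theory Num.Theory.
Import numFieldNormedType.Exports.
Local Open Scope classical_set_scope.
Local Open Scope ring_scope.

(** Write z = lambda T = x - J(x - gamma B x), fix a zero xs of A + B and put
    v = x' + beta T, u = a (x - xs) + m v. The equation reads
    v' = - alpha v - K T, and the relation between a, m and c removes the cross
    term <x - xs, v> from the derivative of
      E = |u|^2 / 2 + c |x - xs|^2 / 2,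
    so that E' <= - W_v |v|^2 / 2 - W_T |T|^2 by cocoercivity of T. Hence x, z
    and m x' are bounded; nonexpansiveness of the resolvent then bounds z', the
    equation bounds x'', and since z and m x' are Lipschitz and square
    integrable in the time variable ln m, they tend to 0 (Barbalat).

    Two points need an argument of their own. That the resolvent is everywhere
    defined is Minty's theorem, proved by minimising the Fitzpatrick function.
    That E decreases is not immediate because a, m and c are only
    differentiable, hence E need not be absolutely continuous; see
    [null_variation]. *)

Set Implicit Arguments.
Unset Strict Implicit.

(** * Monotone operators in a Hilbert space *)

(** Absorbing [beta T] into [v] removes the derivative of [T] from [v'], so the dissipation is
    expressed through [T] itself. The time [ln m] is dictated by the growth hypotheses: its speed
    [dm / m] is the common rate bounding [gamma' / gamma] and [lambda' / lambda], hence also the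
    derivatives of [z] and of [m x'], while the dissipation dominates a multiple of [dm / m] times
    [|z|^2] and [|m x'|^2]. In this time both functions are Lipschitz with constants independent of
    [m]. The residual [z] replaces [T] because [lambda] no longer occurs in it and [gamma] enters
    through nonexpansive maps only; its derivative is bounded through increments, without any
    formula for the derivative of a resolvent. No derivative is ever integrated: each decrease,
    including the one behind Barbalat's argument, is the monotonicity of an explicit auxiliary
    function. *)

Section InnerProduct.
Context {R : realType} {H : completeNormedModType R} {ip : H -> H -> R}.
Hypothesis ip_inner : inner_product ip.

Lemma ipC x y : ip x y = ip y x.
Proof. by case: ip_inner => + _ _; exact. Qed.

Lemma ipDl x y z : ip (x + y) z = ip x z + ip y z.
Proof. by case: ip_inner => _ /(_ 1 x y z) + _; rewrite scale1r mul1r. Qed.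

Lemma ip0l z : ip 0 z = 0.
Proof. by apply: (addrI (ip 0 z)); rewrite -ipDl !addr0. Qed.

Lemma ipZl k x z : ip (k *: x) z = k * ip x z.
Proof. by case: ip_inner => _ /(_ k x 0 z) + _; rewrite ip0l !addr0. Qed.

Lemma ipDr x y z : ip z (x + y) = ip z x + ip z y.
Proof. by rewrite ipC ipDl !(ipC z). Qed.

Lemma ipZr k x z : ip z (k *: x) = k * ip z x.
Proof. by rewrite ipC ipZl (ipC z). Qed.

Lemma ipNl x z : ip (- x) z = - ip x z.
Proof. by rewrite -scaleN1r ipZl mulN1r. Qed.

Lemma ipNr x z : ip z (- x) = - ip z x.
Proof. by rewrite ipC ipNl (ipC z). Qed.

Lemma ip_norm x : `|x| ^+ 2 = ip x x.
Proof. by case: ip_inner. Qed.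

Lemma ip_ge0 x : 0 <= ip x x.
Proof. by rewrite -ip_norm exprn_ge0. Qed.

Definition ipE := (ip_norm, ipDl, ipDr, ipNl, ipNr, ipZl, ipZr).

Lemma ip_polar x y : ip x y = 2^-1 * (`|x + y| ^+ 2 - `|x| ^+ 2 - `|y| ^+ 2).
Proof. by rewrite !ipE (ipC y x); field. Qed.

Lemma ip_ge_normN x y : - (`|x| * `|y|) <= ip x y.
Proof.
have : `|x - y| ^+ 2 <= (`|x| + `|y|) ^+ 2.
  by rewrite ler_sqr ?nnegrE ?addr_ge0 // -(normrN y) ler_normD.
by have := ip_polar x (- y); rewrite ipNr normrN sqrrD; lra.
Qed.

Lemma cvg_ip {T : Type} {F : set_system T} {FF : Filter F} (f g : T -> H) u v :
  f @ F --> u -> g @ F --> v -> (fun t => ip (f t) (g t)) @ F --> ip u v.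
Proof.
move=> fu gv; rewrite ip_polar.
under eq_fun do rewrite ip_polar.
apply: cvgMr; apply: cvgB; [apply: cvgB|].
- by under eq_fun do rewrite expr2; apply: cvgM; apply: cvg_norm; apply: cvgD.
- by under eq_fun do rewrite expr2; apply: cvgM; apply: cvg_norm.
- by under eq_fun do rewrite expr2; apply: cvgM; apply: cvg_norm.
Qed.

(** First-order optimality: along a segment of parameter [s] the objective increases by
    [s p + s^2 q], and dividing by a small [s] leaves [p]. *)
Lemma ge0_of_quadratic (p q : R) :
  (forall s, 0 < s -> s <= 1 -> 0 <= s * p + s ^+ 2 * q) -> 0 <= p.
Proof.
move=> h; rewrite leNgt; apply/negP => p0.
have d0 : 0 < `|p| + `|q| by rewrite ltr_pwDl // normr_gt0 lt_eqF.
(* With this choice [s |q| <= |p| / 2], too little to offset a negative [p]. *)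
pose s := `|p| / (2 * (`|p| + `|q|)).
have s0 : 0 < s by rewrite divr_gt0 ?mulr_gt0 // normr_gt0 lt_eqF.
have s1 : s <= 1.
  rewrite ler_pdivrMr ?mulr_gt0 // mul1r.
  by have := normr_ge0 p; have := normr_ge0 q; lra.
have sE : s * (2 * (`|p| + `|q|)) = `|p| by rewrite divfK // gt_eqF ?mulr_gt0.
have := h s s0 s1; rewrite -[s * p](mulrC p) expr2 -mulrA (mulrC p) -mulrDr.
rewrite pmulr_rge0 // => pq.
have pE : `|p| = - p by rewrite ltr0_norm.
have qs : s * q <= s * `|q| by rewrite ler_pM2l // ler_norm.
have : 0 <= s * `|p| by rewrite mulr_ge0 // ltW.
by nra.
Qed.

(** The form in which a minimising sequence is Cauchy: values within [harmonic n] of the infimum and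
    the parallelogram law yield such an estimate. *)
Lemma cvg_of_sqr_harmonic (x : nat -> H) (C : R) :
  (forall n k, `|x n - x k| ^+ 2 <= C * (harmonic n + harmonic k)) ->
  cvg (x @ \oo).
Proof.
move=> xC; apply/cauchy_cvgP/cauchy_exP => e e0.
have C0 : 0 <= C.
  have := le_trans (exprn_ge0 2 (normr_ge0 _)) (xC 0%N 0%N).
  by rewrite pmulr_lge0 // addr_gt0 ?harmonic_gt0.
have d0 : 0 < e ^+ 2 / (2 * (C + 1)).
  by rewrite divr_gt0 ?exprn_gt0 ?mulr_gt0 ?ltr_wpDl.
have /cvgrPdist_lt /(_ _ d0) [N _ hN] := @cvg_harmonic R.
have {}hN n : (N <= n)%N -> harmonic n < e ^+ 2 / (2 * (C + 1)).
  by move=> Nn; have := hN n Nn; rewrite /= sub0r normrN gtr0_norm ?harmonic_gt0.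
exists (x N); exists N => // n Nn; rewrite -ball_normE /=.
rewrite -(ltr_pXn2r (n := 2)) ?nnegrE // ?ltW //.
apply: le_lt_trans (xC _ _) _.
have : harmonic N + harmonic n < e ^+ 2 / (C + 1).
  have := hN N (leqnn _); have := hN n Nn.
  by rewrite invfM mulrA (mulrAC _ 2^-1) => ? ?; lra.
rewrite ltr_pdivlMr ?ltr_wpDl // mulrDr mulr1 mulrC => h.
by have := @harmonic_gt0 R N; have := @harmonic_gt0 R n; lra.
Qed.

(* The couple (x, - x) is obtained from the minimiser over H x H of
   F(y, v) + |y|^2 / 2 + |v|^2 / 2, where F is the Fitzpatrick function of M;
   S below is the epigraph of F. *)
Lemma minty (M : H -> H -> Prop) :
  (forall x y u v, M x u -> M y v -> 0 <= ip (x - y) (u - v)) ->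
  (forall x u, (forall y v, M y v -> 0 <= ip (x - y) (u - v)) -> M x u) ->
  exists x, M x (- x).
Proof.
move=> mono maxi.
(* If [M] were empty, [maxi] would hold vacuously and put [(0, 0)] into it. *)
have [y0 [v0 M0]] : exists y v, M y v.
  apply: contrapT => nM; apply: (nM); exists 0, 0; apply: maxi => y v Myv.
  by exfalso; apply: nM; exists y, v.
pose S (z : H * H * R) :=
  forall y v, M y v -> ip z.1.1 v + ip y z.1.2 - ip y v <= z.2.
pose g (z : H * H * R) := z.2 + (ip z.1.1 z.1.1 + ip z.1.2 z.1.2) / 2.
have SM y v : M y v -> S (y, v, ip y v).
  move=> Myv y' v' My'v' /=; have := mono _ _ _ _ Myv My'v'.
  by rewrite !ipE; lra.
(* The affine minorant of [F] given by [(y0, v0)] leaves this constant once two squares are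
   completed. *)
have g_lb : lbound (g @` S) (- (ip (y0 + v0) (y0 + v0)) / 2).
  move=> _ [z Sz <-]; have := Sz _ _ M0; rewrite /g !ipE (ipC v0 y0).
  have := ip_ge0 (z.1.1 + v0); have := ip_ge0 (z.1.2 + y0).
  by rewrite !ipE (ipC v0) (ipC z.1.2 y0); lra.
have g_inf : has_inf (g @` S).
  split; last by eexists; exact: g_lb.
  by exists (g (y0, v0, ip y0 v0)); exists (y0, v0, ip y0 v0) => //; exact: SM.
pose I := inf (g @` S).
have gI z : S z -> I <= g z.
  by move=> Sz; apply: ge_inf; [case: g_inf | exists z].
have /choice[z hz] (n : nat) : exists z, S z /\ g z < I + harmonic n.
  have [_ [z Sz <-] gz] := inf_adherent (@harmonic_gt0 R n) g_inf.
  by exists z.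
(* Parallelogram law: [S] is convex, so [g] is at least [I] at the midpoint. *)
have mid n k : ip ((z n).1.1 - (z k).1.1) ((z n).1.1 - (z k).1.1)
             + ip ((z n).1.2 - (z k).1.2) ((z n).1.2 - (z k).1.2)
             <= 4 * (harmonic n + harmonic k).
  have [Sn gn] := hz n; have [Sk gk] := hz k.
  pose w : H * H * R := (2^-1 *: ((z n).1.1 + (z k).1.1),
                         2^-1 *: ((z n).1.2 + (z k).1.2),
                         2^-1 * ((z n).2 + (z k).2)).
  have Sw : S w.
    move=> y v Myv; have := Sn _ _ Myv; have := Sk _ _ Myv.
    by rewrite /w /= !ipE; lra.
  have := gI _ Sw; move: gn gk; move: (harmonic n) (harmonic k) => hn hk.
  rewrite /g /w /= !ipE.
  by rewrite (ipC (z k).1.1 (z n).1.1) (ipC (z k).1.2 (z n).1.2); lra.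
have cx : cvg ((fun n => (z n).1.1) @ \oo).
  apply: (@cvg_of_sqr_harmonic _ 4) => n k; rewrite ip_norm.
  by apply: le_trans (mid n k); rewrite lerDl ip_ge0.
have cu : cvg ((fun n => (z n).1.2) @ \oo).
  apply: (@cvg_of_sqr_harmonic _ 4) => n k; rewrite ip_norm.
  by apply: le_trans (mid n k); rewrite lerDr ip_ge0.
set x0 := lim _ in cx; set u0 := lim _ in cu.
(* The height that makes [g (x0, u0, r0)] equal to [I]. *)
pose r0 := I - (ip x0 x0 + ip u0 u0) / 2.
have S0 : S (x0, u0, r0).
  move=> y v Myv /=.
  have c1 : (fun n => ip (z n).1.1 v + ip y (z n).1.2 - ip y v) @ \oo
            --> ip x0 v + ip y u0 - ip y v.
    by apply: cvgB; [apply: cvgD; apply: cvg_ip => //|]; exact: cvg_cst.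
  have c2 : (fun n => I + harmonic n - (ip (z n).1.1 (z n).1.1
                                        + ip (z n).1.2 (z n).1.2) / 2) @ \oo
            --> r0.
    rewrite /r0 -{2}(addr0 I); apply: cvgB.
      by apply: cvgD; [exact: cvg_cst | exact: cvg_harmonic].
    by apply: cvgMl; apply: cvgD; exact: cvg_ip.
  apply: ler_cvg_to c1 c2 _; apply: nearW => n.
  have [Sn gn] := hz n; have := Sn _ _ Myv; move: gn; rewrite /g; lra.
(* [F] dominates the pairing: otherwise [(x0, u0)] would be monotonically related to all of [M],
   hence in [M], where [F] is at least the pairing. *)
have r0_ge : ip x0 u0 <= r0.
  rewrite leNgt; apply/negP => r0_lt.
  have /S0 /= : M x0 u0.
    by apply: maxi => y v Myv; have := S0 _ _ Myv; rewrite /= !ipE; lra.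
  by lra.
have opt y v : M y v -> r0 + ip x0 x0 + ip u0 u0 <= ip y v + ip x0 y + ip u0 v.
  move=> Myv.
  suff : 0 <= ip y v - r0 + ip x0 (y - x0) + ip u0 (v - u0) by rewrite !ipE; lra.
  apply: (@ge0_of_quadratic _ ((ip (y - x0) (y - x0) + ip (v - u0) (v - u0)) / 2)).
  move=> s s0 s1.
  have Sw : S (x0 + s *: (y - x0), u0 + s *: (v - u0), r0 + s * (ip y v - r0)).
    move=> y' v' My'v' /=; have := S0 _ _ My'v'; have := SM _ _ Myv _ _ My'v'.
    rewrite /= !ipE => h1 h2.
    have := ler_wpM2l (ltW s0) h1; have : 0 <= 1 - s by lra.
    by move=> /ler_wpM2l/(_ _ _ h2); lra.
  have := gI _ Sw; rewrite /g /= !ipE /r0.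
  rewrite (ipC y x0) (ipC v u0); nra.
(* By [opt] and [r0_ge], [<y + u0, v + x0>] is at least [|x0 + u0|^2], so that [(- u0, - x0)] is
   related to all of [M]. Then [opt] at this very couple forces [x0 + u0 = 0]. *)
have Mu0 : M (- u0) (- x0).
  apply: maxi => y v Myv; have := opt _ _ Myv; have := ip_ge0 (x0 + u0).
  by rewrite !ipE (ipC y x0) (ipC u0 x0); lra.
exists (- u0); suff -> : - - u0 = - x0 by [].
have : ip (x0 + u0) (x0 + u0) <= 0.
  by have := opt _ _ Mu0; rewrite !ipE (ipC u0 x0); lra.
rewrite -ip_norm => n0.
have /eqP : `|x0 + u0| ^+ 2 == 0 by rewrite eq_le n0 exprn_ge0.
move=> /eqP; rewrite expf_eq0 /= normr_eq0 addrC addr_eq0 => /eqP ->.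
by rewrite opprK.
Qed.

Lemma norm_le_of_ip (u v : H) : ip u u <= ip v v -> `|u| <= `|v|.
Proof. by rewrite -!ip_norm ler_sqr ?nnegrE. Qed.

Lemma comonotone_add (rho : R) (A : H -> set H) p u :
  comonotone ip rho A ->
  (forall q v, A q v -> rho * `|u - v| ^+ 2 <= ip (p - q) (u - v)) ->
  comonotone ip rho (fun q => [set v | A q v \/ q = p /\ v = u]).
Proof.
move=> coA h x y v w [Axv|[-> ->]] [Ayw|[-> ->]].
- exact: coA.
- rewrite distrC -(opprB p) -(opprB u v) ipNl ipNr opprK; exact: h.
- exact: h.
- by rewrite !subrr normr0 expr0n mulr0 ip0l.
Qed.

(** The working form of maximality: a couple compatible with the whole graph can be adjoined to it
    by [comonotone_add], hence already belongs to it. *)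
Lemma maximal_comonotone_mem (rho : R) (A : H -> set H) p u :
  maximal_comonotone ip rho A ->
  (forall q v, A q v -> rho * `|u - v| ^+ 2 <= ip (p - q) (u - v)) -> A p u.
Proof.
move=> [coA maxA] h; have := maxA _ (comonotone_add coA h).
by move=> <- /=; [right | move=> q v; left].
Qed.

Definition forward (g : R) (B : H -> H) x := x - g *: B x.

Lemma forwardB (g : R) B x y :
  forward g B x - forward g B y = (x - y) - g *: (B x - B y).
Proof. by rewrite /forward scalerBr !opprD !opprK addrACA. Qed.

(** This is [lambda T]; only the changes of [gamma] and of the point remain to be estimated. *)
Definition residual (g : R) (A : H -> set H) (B : H -> H) x :=
  x - resolvent g A (forward g B x).

(** * Resolvents and forward-backward steps *)

Section Resolvent.
Context {rho : R} {A : H -> set H}.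
Hypothesis A_max : maximal_comonotone ip rho A.

(** Comonotonicity says that the inverse of [A] minus [rho Id] is monotone. [M] is this operator
    translated by [y] and divided by [g + rho]; a couple [(u, - u)] in it means that [u] belongs to
    [A (y - g u)]. *)
Lemma resolvent_exists (g : R) y : 0 < g + rho ->
  exists p, op_inv (op_Id_plus g A) y p.
Proof.
move=> g0; pose M u w := A (y + rho *: u + (g + rho) *: w) u.
have [||u Mu] := @minty M.
- move=> u u' w w' Au Au'; have := A_max.1 _ _ _ _ Au Au'.
  rewrite !ipE (ipC u' u) (ipC w u) (ipC w' u) (ipC w u') (ipC w' u').
  by move=> h; rewrite -(pmulr_rge0 _ g0); lra.
- move=> u w h; apply: maximal_comonotone_mem A_max _ => q v Aqv.
  have Mv : M v ((g + rho)^-1 *: (q - y - rho *: v)).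
    rewrite /M scalerA divff ?gt_eqF // scale1r.
    by rewrite (_ : y + _ + _ = q) // -[q - y - _]addrA -opprD [LHS]addrC subrK.
  have := h _ _ Mv; rewrite -(pmulr_rge0 _ g0) -ipZr scalerBr scalerA.
  rewrite divff ?gt_eqF // scale1r !ipE.
  by rewrite (ipC v u) (ipC v w) (ipC v y) (ipC v q) (ipC u w) (ipC u y) (ipC u q); lra.
- exists (y - g *: u), u.
    by move: Mu; rewrite /M scalerN -addrA -scalerBl opprD addrCA subrr addr0 scaleNr.
  by rewrite subrK.
Qed.

Lemma resolvent_mem (g : R) y : 0 < g -> 0 < g + rho ->
  A (resolvent g A y) (g^-1 *: (y - resolvent g A y)).
Proof.
move=> g0 g1; have [u Au /= uE] := xgetPex 0 (resolvent_exists y g1).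
rewrite -/(resolvent g A y) in uE Au.
by rewrite -{2}uE addrC addKr scalerA mulVf ?gt_eqF // scale1r.
Qed.

(** With [d = p - q] and [e = u - v], [|d + g e|^2 >= |d|^2 + g (g + 2 rho) |e|^2]: here the bound
    [- 2 rho < g] enters. *)
Lemma comonotone_step (g : R) p q u v : 0 < g + 2 * rho -> 0 < g ->
  A p u -> A q v -> `|p - q| <= `|p + g *: u - (q + g *: v)|.
Proof.
move=> g1 g0 Ap Aq; apply: norm_le_of_ip; have := A_max.1 _ _ _ _ Ap Aq.
have -> : p + g *: u - (q + g *: v) = (p - q) + g *: (u - v).
  by rewrite scalerBr addrACA opprD.
move: (p - q) (u - v) => d e; rewrite !ipE (ipC e d) => h.
have := mulr_ge0 (mulr_ge0 (ltW g0) (ltW g1)) (ip_ge0 e).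
by have := ler_wpM2l (ltW g0) h; lra.
Qed.

Section Steps.
Context {g : R}.
Hypotheses (g0 : 0 < g) (g1 : 0 < g + 2 * rho).

Lemma step_gt0 : 0 < g + rho. Proof. by have := g0; have := g1; lra. Qed.

Lemma resolventE p u : A p u -> resolvent g A (p + g *: u) = p.
Proof.
move=> Ap; have Aq := resolvent_mem (p + g *: u) g0 step_gt0.
apply/eqP; rewrite -subr_eq0 -normr_le0.
apply: le_trans (comonotone_step g1 g0 Aq Ap) _.
by rewrite scalerA divff ?gt_eqF // scale1r subrKC subrr normr0.
Qed.

Lemma resolvent_nonexpansive y z :
  `|resolvent g A y - resolvent g A z| <= `|y - z|.
Proof.
have Ay := resolvent_mem y g0 step_gt0; have Az := resolvent_mem z g0 step_gt0.
have := comonotone_step g1 g0 Ay Az.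
by rewrite !scalerA divff ?gt_eqF // !scale1r !subrKC.
Qed.

(** Resolvent identity: for [p = J_{g'} y] and [u = (y - p) / g'], one has [p = J_g (p + g u)]
    whereas [y = p + g' u]; the two arguments of [J_g] differ by [(g - g') u]. *)
Lemma resolvent_step (g' : R) y : 0 < g' -> 0 < g' + 2 * rho ->
  `|resolvent g A y - resolvent g' A y| <=
  `|g - g'| * (g'^-1 * `|y - resolvent g' A y|).
Proof.
move=> g'0 g'1; have g'2 : 0 < g' + rho by lra.
set p := resolvent g' A y; set u := g'^-1 *: (y - p).
have Ap : A p u by exact: resolvent_mem.
have <- : `|u| = g'^-1 * `|y - p| by rewrite normrZ gtr0_norm ?invr_gt0.
rewrite -{1}(resolventE Ap) -normrZ; apply: le_trans (resolvent_nonexpansive _ _) _.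
have {1}-> : y = p + g' *: u.
  by rewrite scalerA divff ?gt_eqF // scale1r subrKC.
by rewrite opprD addrACA subrr add0r -scalerBl !normrZ distrC.
Qed.

Context {nu : R} {B : H -> H}.
Hypotheses (nu0 : 0 < nu) (B_coco : cocoercive ip nu B) (g2 : g <= 2 * nu).

(** Cocoercivity gives [|d - g e|^2 <= |d|^2 - g (2 nu - g) |e|^2], where [d = x - y] and
    [e = B x - B y]. *)
Lemma forward_nonexpansive x y : `|forward g B x - forward g B y| <= `|x - y|.
Proof.
apply: norm_le_of_ip; have := B_coco x y.
rewrite forwardB; move: (x - y) (B x - B y) => d e; rewrite !ipE (ipC e d) => h.
have := ler_wpM2l (ltW g0) h; have := ler_wpM2r (ip_ge0 e) g2.
by move=> /(ler_wpM2l (ltW g0)); lra.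
Qed.

Lemma residual_zer xs : zer (op_add A B) xs -> residual g A B xs = 0.
Proof.
case=> u Au uB; rewrite /residual.
have -> : forward g B xs = xs + g *: u.
  rewrite /forward -scalerN; congr (_ + _ *: _).
  by apply/esym/eqP; rewrite -addr_eq0; apply/eqP.
by rewrite resolventE // subrr.
Qed.

Lemma residual_lipschitz x y : `|residual g A B x - residual g A B y| <= 2 * `|x - y|.
Proof.
rewrite /residual opprD opprK addrACA; apply: le_trans (ler_normD _ _) _.
rewrite mulr_natl mulr2n lerD // addrC distrC.
exact: le_trans (resolvent_nonexpansive _ _) (forward_nonexpansive _ _).
Qed.

(** Adding [g^2] times the cocoercivity of [B] to the comonotonicity of [A] cancels [<e, y>] and
    gives [g <y, z> >= (rho + g) |z|^2 - g (g + 2 rho) <z, e> + g^2 (nu + rho) |e|^2]. Minimising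
    the right-hand side over [e] and dividing by [g] produces the constant. *)
Lemma residual_cocoercive x xs : zer (op_add A B) xs ->
  (4 * nu * (rho + g) - g ^+ 2) / (4 * g * (nu + rho)) * `|residual g A B x| ^+ 2
  <= ip (x - xs) (residual g A B x).
Proof.
move=> zs.
have nr : 0 < nu + rho by have := g1; have := g2; lra.
have Ax := resolvent_mem (forward g B x) g0 step_gt0.
have As := resolvent_mem (forward g B xs) g0 step_gt0.
have rs' := residual_zer zs; rewrite /residual in rs'.
have := A_max.1 _ _ _ _ Ax As; have := B_coco x xs.
set z := residual g A B x; set e := B x - B xs; set y := x - xs.
have -> : resolvent g A (forward g B x) - resolvent g A (forward g B xs) = y - z.
  by rewrite -(subr0_eq rs') /y /z /residual opprB [RHS]addrC subrKA.
have -> : g^-1 *: (forward g B x - resolvent g A (forward g B x))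
        - g^-1 *: (forward g B xs - resolvent g A (forward g B xs))
        = g^-1 *: (z - g *: e).
  rewrite -scalerBr -(subr0_eq rs'); congr (_ *: _).
  rewrite /forward /z /residual /e.
  rewrite opprB subKr scalerBr [in RHS]opprD opprK addrA.
  by congr (_ + _); rewrite addrAC.
move: z e y => z e y h1 h2.
have {}h2 : rho * ip (z - g *: e) (z - g *: e) <= g * ip (y - z) (z - g *: e).
  have := ler_wpM2l (ltW (mulr_gt0 g0 g0)) h2; rewrite ip_norm !ipZl !ipZr.
  have gV : g * g^-1 = 1 by rewrite divff ?gt_eqF.
  rewrite [X in X <= _](_ : _ = (g * g^-1) * (g * g^-1)
    * (rho * ip (z - g *: e) (z - g *: e))); last by ring.
  rewrite [X in _ <= X](_ : _ = (g * g^-1) * (g * ip (y - z) (z - g *: e))); last by ring.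
  by rewrite gV !mul1r.
have G0 : 0 < 4 * g * (nu + rho) by rewrite !mulr_gt0.
rewrite mulrAC ler_pdivrMr //.
have := ip_ge0 ((2 * g * (nu + rho)) *: e - (g + 2 * rho) *: z).
move: h1 h2; rewrite !ipE (ipC e z) (ipC e y) => h1 h2 h3.
have h4 := ler_wpM2l (ltW (mulr_gt0 g0 g0)) h1.
have h5 := ler_wpM2l (ltW nr) (lerD h2 h4).
clear h1 h2 h4; lra.
Qed.

(** The factor of [|g - g'|] depends on [g'] and [y] alone, so that with these fixed the estimate
    bounds a derivative. *)
Lemma residual_step (g' : R) x y : 0 < g' -> 0 < g' + 2 * rho ->
  `|residual g A B x - residual g' A B y| <= 2 * `|x - y| + `|g - g'| *
  (2 * `|B y| + g'^-1 * `|residual g' A B y|).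
Proof.
move=> g'0 g'1; have gV : g'^-1 * g' = 1 by rewrite mulVf ?gt_eqF.
set r' := residual g' A B y; pose r := residual g A B y.
apply: (@le_trans _ _ (`|residual g A B x - r| + `|r - r'|)).
  by rewrite -[residual g A B x - r'](subrKA r) ler_normD.
rewrite lerD ?residual_lipschitz //.
(* Intermediate point: the parameter is changed in the resolvent but not yet in the forward step. *)
pose q := resolvent g A (forward g' B y).
have -> : r - r' = (resolvent g' A (forward g' B y) - q)
                 + (q - resolvent g A (forward g B y)).
  by rewrite subrKA /r /r' /residual opprD opprK addrACA subrr add0r addrC.
apply: le_trans (ler_normD _ _) _; rewrite distrC.
have h1 := resolvent_step (forward g' B y) g'0 g'1.
have h2 := resolvent_nonexpansive (forward g' B y) (forward g B y).
have h3 : `|forward g' B y - forward g B y| = `|g - g'| * `|B y|.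
  by rewrite /forward opprD opprK addrACA subrr add0r addrC -scalerBl normrZ.
have h4 : `|forward g' B y - resolvent g' A (forward g' B y)| <= `|r'| + g' * `|B y|.
  rewrite /forward addrAC; apply: le_trans (ler_normD _ _) _.
  by rewrite normrN normrZ gtr0_norm.
have h5 : g'^-1 * `|forward g' B y - resolvent g' A (forward g' B y)|
    <= g'^-1 * `|r'| + `|B y|.
  apply: le_trans (ler_wpM2l _ h4) _; first by rewrite invr_ge0 ltW.
  by rewrite mulrDr mulrA gV mul1r.
have h6 := ler_wpM2l (normr_ge0 (g - g')) h5.
rewrite h3 in h2; move: h1 h2 h6; rewrite -/q; lra.
Qed.

End Steps.
End Resolvent.

Lemma scaler_splitting (l g : R) A B (x : H) : l != 0 ->
  l *: splitting l g A B x = residual g A B x.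
Proof. by move=> l0; rewrite scalerA divff // scale1r. Qed.

Lemma yosida_splitting (l g : R) A B (x : H) : l != 0 -> g != 0 ->
  yosida g A (x - g *: B x) + B x = (l / g) *: splitting l g A B x.
Proof.
move=> l0 g0; rewrite /yosida mulrC -scalerA scaler_splitting //.
by rewrite addrAC scalerBr scalerA mulVf // scale1r subrK.
Qed.
End InnerProduct.

(** * Derivatives on a half-line *)

Lemma near_cvg {T : Type} {U : topologicalType} {F : set_system T}
    {FF : Filter F} (f g : T -> U) (l : U) :
  (\forall s \near F, f s = g s) -> f @ F --> l -> g @ F --> l.
Proof. by move=> fg; apply: cvg_trans; exact: near_eq_cvg. Qed.

Section Calculus.
Context {R : realType} (t0 : R).
Implicit Types (V W : normedModType R) (t : R).

(** A relation rather than the total function [deriv_from], whose value means nothing unless the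
    limit exists. *)
Definition has_deriv_from V (f : R -> V) t (l : V) :=
  diff_quotient f t s @[s --> within `[t0, +oo[ t^'] --> l.

Lemma ray_proper t : t0 <= t -> ProperFilter (within `[t0, +oo[ t^').
Proof.
move=> t0t; apply: Build_ProperFilter => -[e /= e0 eP].
apply: (eP (t + e / 2)) => /=.
- rewrite opprD addrA subrr sub0r normrN gtr0_norm ?divr_gt0 //.
  by rewrite ltr_pdivrMr // mulr_natr mulr2n ltrDl.
- by rewrite gt_eqF // ltrDl divr_gt0.
- by rewrite in_itv /= andbT (le_trans t0t) // lerDl divr_ge0 // ltW.
Qed.

Lemma within_rayP t (P : R -> Prop) :
  (\forall s \near within `[t0, +oo[ (nbhs t), P s) <->
  exists2 d, 0 < d & forall s, t0 <= s -> `|s - t| < d -> P s.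
Proof.
split=> [[d /= d0 dP]|[d d0 dP]]; exists d => //.
  by move=> s t0s st; apply: dP; rewrite /= ?in_itv /= ?andbT // distrC.
by move=> s /= st; rewrite in_itv /= andbT => t0s; apply: dP => //; rewrite distrC.
Qed.

Lemma within_dray t (P : R -> Prop) :
  (\forall s \near within `[t0, +oo[ t^', P s) -> P t ->
  \forall s \near within `[t0, +oo[ (nbhs t), P s.
Proof.
move=> [d /= d0 dP] Pt; apply/within_rayP; exists d => // s t0s st.
have [->//|sNt] := eqVneq s t.
by apply: dP; rewrite /= ?in_itv /= ?andbT // distrC.
Qed.

Lemma ray_neq t : \forall s \near within `[t0, +oo[ t^', s - t != 0.
Proof. by exists 1 => //= s _ st _; rewrite subr_eq0. Qed.

Lemma derivable_fromP V (f : R -> V) t :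
  derivable_from t0 f t -> has_deriv_from f t (deriv_from t0 f t).
Proof. by []. Qed.

Lemma has_deriv_derivable V (f : R -> V) t l :
  has_deriv_from f t l -> derivable_from t0 f t.
Proof. by move=> h; apply/cvg_ex; exists l. Qed.

Lemma deriv_fromE V (f : R -> V) t l : t0 <= t ->
  has_deriv_from f t l -> deriv_from t0 f t = l.
Proof.
by move=> t0t h; have := ray_proper t0t => PF; apply: cvg_lim.
Qed.

Lemma diff_quotientK V (f : R -> V) t s :
  s - t != 0 -> f s = f t + (s - t) *: diff_quotient f t s.
Proof. by move=> st; rewrite scalerA divff // scale1r subrKC. Qed.

Lemma cvg_sub_ray t : (s - t) @[s --> within `[t0, +oo[ t^'] --> (0 : R).
Proof.
rewrite -[0](subrr t); apply: cvgB; last exact: cvg_cst.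
apply: (@cvg_trans _ (id @ nbhs t)); last exact: cvg_id.
move=> P [d /= d0 dP]; exists d => //= s st _ _; exact: dP.
Qed.

Lemma has_deriv_cvg V (f : R -> V) t l : has_deriv_from f t l ->
  f s @[s --> within `[t0, +oo[ t^'] --> f t.
Proof.
move=> h; have : (f t + (s - t) *: diff_quotient f t s)
    @[s --> within `[t0, +oo[ t^'] --> f t + 0 *: l.
  by apply: cvgD; [exact: cvg_cst | apply: cvgZ => //; exact: cvg_sub_ray].
rewrite scale0r addr0; apply: near_cvg.
near=> s; rewrite -diff_quotientK //; near: s; exact: ray_neq.
Unshelve. all: by end_near. Qed.

Lemma has_deriv_eq V (f g : R -> V) t l : (forall s, t0 <= s -> f s = g s) ->
  t0 <= t -> has_deriv_from f t l -> has_deriv_from g t l.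
Proof.
move=> fg t0t h; refine (near_cvg _ h).
exists 1 => //= s _ _; rewrite in_itv /= andbT => t0s.
by rewrite /diff_quotient !fg.
Qed.

Lemma has_deriv_cst V (k : V) t : has_deriv_from (fun=> k) t 0.
Proof.
rewrite /has_deriv_from /diff_quotient subrr.
under eq_fun do rewrite scaler0; exact: cvg_cst.
Qed.

Lemma has_deriv_id t : has_deriv_from id t 1.
Proof.
apply: near_cvg (cvg_cst (1 : R)); near=> s.
rewrite /diff_quotient /= /GRing.scale /= mulVf //; near: s; exact: ray_neq.
Unshelve. all: by end_near. Qed.

Lemma has_derivD V (f g : R -> V) t l k : has_deriv_from f t l ->
  has_deriv_from g t k -> has_deriv_from (fun s => f s + g s) t (l + k).
Proof.
move=> hf hg; refine (near_cvg _ (cvgD hf hg)).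
by apply: nearW => s; rewrite fctE /diff_quotient -scalerDr addrACA opprD.
Qed.

Lemma has_derivZ V (f : R -> R) (g : R -> V) t l k : has_deriv_from f t l ->
  has_deriv_from g t k -> has_deriv_from (fun s => f s *: g s) t (f t *: k + l *: g t).
Proof.
move=> hf hg.
refine (near_cvg _ (cvgD (cvgZ (has_deriv_cvg hf) hg) (cvgZ hf (cvg_cst (g t))))).
apply: nearW => s; rewrite fctE.
rewrite (_ : diff_quotient f t s *: g t = (s - t)^-1 *: ((f s - f t) *: g t)); last first.
  by rewrite scalerA.
rewrite /diff_quotient scalerA mulrC -scalerA -scalerDr; congr (_ *: _).
by rewrite scalerBr scalerBl subrKA.
Qed.

Lemma has_derivM (f g : R -> R) t l k : has_deriv_from f t l ->
  has_deriv_from g t k -> has_deriv_from (fun s => f s * g s) t (f t * k + l * g t).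
Proof. exact: has_derivZ. Qed.

Lemma has_deriv_scale V (c : R) (f : R -> V) t l : has_deriv_from f t l ->
  has_deriv_from (fun s => c *: f s) t (c *: l).
Proof.
by move=> h; have := has_derivZ (has_deriv_cst c t) h; rewrite scale0r addr0.
Qed.

Lemma has_derivB V (f g : R -> V) t l k : has_deriv_from f t l ->
  has_deriv_from g t k -> has_deriv_from (fun s => f s - g s) t (l - k).
Proof.
move=> hf hg; have := has_derivD hf (has_deriv_scale (c := -1) hg).
by rewrite scaleN1r; under eq_fun do rewrite scaleN1r.
Qed.

Lemma has_deriv_comp (g f : R -> R) t l k : is_derive (f t) 1 g k ->
  has_deriv_from f t l -> has_deriv_from (g \o f) t (k * l).
Proof.
move=> gk fl.
(* The difference quotient of [g] is extended by [k] at 0, because [f s] may equal [f t] for [s]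
   arbitrarily close to [t]. *)
pose q h := if h == 0 then k else h^-1 * (g (h + f t) - g (f t)).
have qc : q h @[h --> 0] --> k.
  have -> : k = q 0 by rewrite /q eqxx.
  apply/continuous_withinNx; rewrite {2}/q eqxx.
  have [dg <-] := gk; refine (near_cvg _ dg); near=> h.
  rewrite /q ifF; last by apply/negbTE; near: h; exact: nbhs_dnbhs_neq.
  by rewrite /= /GRing.scale /= mulr1.
have h : q (f s - f t) * diff_quotient f t s @[s --> within `[t0, +oo[ t^'] --> k * l.
  apply: cvgM => //; apply: cvg_comp qc.
  by rewrite -[0](subrr (f t)); apply: cvgB; [exact: has_deriv_cvg fl | exact: cvg_cst].
refine (near_cvg _ h); apply: nearW => s.
rewrite /diff_quotient /q /GRing.scale /=; case: eqVneq => [fst|fst].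
  by rewrite fst (subr0_eq fst) subrr !mulr0.
by rewrite subrK mulrCA mulrAC mulVf // mul1r mulrC.
Unshelve. all: by end_near. Qed.

End Calculus.

(** * Monotonicity from the sign of the derivative almost everywhere *)

Section NullVariation.
Context {R : realType}.
Implicit Types (V W : normedModType R) (p q t : R).
Notation mu := (@lebesgue_measure R).

(* Both absolute continuity and pointwise Lipschitz continuity imply this
   property, which is stable under sums and products and is what makes the sign
   of the derivative almost everywhere decide monotonicity: it mixes the
   absolutely continuous velocity with coefficients that are merely
   differentiable. *)
Definition null_variation V p q (f : R -> V) :=
  forall N : set R, measurable N -> mu N = 0%E -> forall e, 0 < e ->
  exists w : R -> R,
    [/\ forall s t, p <= s -> s <= t -> t <= q -> w s <= w t,
        w q - w p <= e
      & forall t, N t -> p <= t < q -> exists2 d, 0 < d &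
          forall s, t < s -> s < t + d -> s <= q -> `|f s - f t| <= w s - w t].

(** Sums, products and squared norms all come from this estimate. The witness is [K] times the sum
    of two given ones, each built for [e / (2 * K)]. *)
Lemma null_variation_comp V W (U : normedModType R) (M p q : R) (f : R -> V)
    (g : R -> W) (h : R -> U) : p <= q ->
  (forall s t, p <= s <= q -> p <= t <= q ->
     `|h s - h t| <= M * (`|f s - f t| + `|g s - g t|)) ->
  null_variation p q f -> null_variation p q g -> null_variation p q h.
Proof.
move=> pq hM nf ng N mN N0 e e0; pose K := `|M| + 1.
have K0 : 0 < K by rewrite ltr_wpDl.
have [u [u1 u2 u3]] := nf N mN N0 (e / (2 * K)) ltac:(by rewrite divr_gt0 ?mulr_gt0).
have [v [v1 v2 v3]] := ng N mN N0 (e / (2 * K)) ltac:(by rewrite divr_gt0 ?mulr_gt0).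
exists (fun s => K * (u s + v s)); split => [s t ps st tq||t Nt ptq].
- by rewrite ler_pM2l // lerD ?u1 ?v1.
- have -> : e = K * (e / (2 * K) + e / (2 * K)) by field; rewrite gt_eqF.
  by rewrite -mulrBr ler_pM2l //; lra.
have [d d0 hd] := u3 t Nt ptq; have [d' d'0 hd'] := v3 t Nt ptq.
exists (Num.min d d') => [|s ts sd sq]; first by rewrite lt_min d0.
have [pt tq] := andP ptq.
apply: le_trans (hM s t _ _) _; [by rewrite sq andbT; lra | by rewrite pt ltW |].
have sd1 : s < t + d by apply: lt_le_trans sd _; rewrite lerD2l ge_min lexx.
have sd2 : s < t + d' by apply: lt_le_trans sd _; rewrite lerD2l ge_min lexx orbT.
rewrite -mulrBr; apply: (@le_trans _ _ (K * (`|f s - f t| + `|g s - g t|))).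
  rewrite ler_wpM2r ?addr_ge0 // /K; have := ler_norm M; lra.
by rewrite ler_pM2l //; have := hd s ts sd1 sq; have := hd' s ts sd2 sq; lra.
Qed.

(** The bound [f t - f p <= e (t - p) + (w t - w p)] is propagated from [p]: off the null set the
    derivative keeps slopes below [e], on it the growth of [w] pays for the increment. Hence the
    supremum of the points where it holds cannot stop before [q]. *)
Lemma nonincreasing_of_deriv_le0 (t0 p q : R) (f : R -> R) : t0 <= p -> p <= q ->
  {within `[t0, +oo[, continuous f} -> null_variation p q f ->
  {ae mu, forall t, p <= t -> exists2 l, l <= 0 & has_deriv_from t0 f t l} ->
  f q <= f p.
Proof.
move=> t0p pq /subspace_continuousP fc fn [N [mN N0 hN]].
suff main e : 0 < e -> f q <= f p + e * (q - p + 1).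
  apply/ler_addgt0Pr => e e0; have qp : 0 < q - p + 1 by lra.
  by have := main _ (divr_gt0 e0 qp); rewrite divfK ?gt_eqF.
move=> e0; have [w [w1 w2 w3]] := fn N mN N0 e e0.
pose S := [set t | p <= t <= q /\ f t - f p <= e * (t - p) + (w t - w p)].
have Sp : S p by split; [lra | rewrite !subrr mulr0 addr0].
have S_sup : has_sup S.
  by split; [exists p | exists q => t [/andP[]]].
pose r := sup S.
have pr : p <= r by apply: ub_le_sup => //; case: S_sup.
have rq : r <= q by apply: ge_sup; [exists p | move=> t [/andP[]]].
have t0r : t0 <= r by exact: le_trans pr.
have Sr : f r - f p <= e * (r - p) + (w r - w p).
  apply/ler_addgt0Pr => k k0.
  have /cvgrPdist_lt/(_ k k0)/within_rayP[d d0 hd] :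
      f @ within `[t0, +oo[ (nbhs r) --> f r.
    by apply: fc; rewrite /= in_itv /= t0r.
  have [t St rt] := sup_adherent d0 S_sup.
  have tr : t <= r by apply: ub_le_sup => //; case: S_sup.
  case: St => /andP[pt tq] St.
  rewrite -/r in rt.
  have td : `|t - r| < d by rewrite ler0_norm; lra.
  move: (hd t (le_trans t0p pt) td); rewrite ltr_norml => /andP[_ h].
  have := w1 _ _ pt tr rq; have : e * (t - p) <= e * (r - p) by rewrite ler_pM2l //; lra.
  by lra.
suff rE : r = q by rewrite rE in Sr; move: Sr w2; nra.
apply/eqP; rewrite eq_le rq /= leNgt; apply/negP => rltq.
suff [s rs [sq hs]] : exists2 s, r < s & s <= q /\ f s - f r <= e * (s - r) + (w s - w r).
  have : S s by split; [lra | move: Sr hs; lra].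
  by move=> /(ub_le_sup (proj2 S_sup)); rewrite -/r; lra.
have [d d0 hd] : exists2 d, 0 < d & forall s, r < s -> s < r + d -> s <= q ->
    f s - f r <= e * (s - r) + (w s - w r).
  have [Nr|nNr] := pselect (N r).
    have [|d d0 hd] := w3 r Nr; first lra.
    exists d => // s rs sd sq; have := hd s rs sd sq; have := ler_norm (f s - f r).
    have : 0 <= e * (s - r) by rewrite mulr_ge0 ?ltW // subr_gt0.
    by lra.
  have : p <= r -> exists2 l, l <= 0 & has_deriv_from t0 f r l.
    by apply: contrapT => h; apply: nNr; apply: hN.
  move=> /(_ pr)[l l0 fl].
  have [d /= d0 hd] := cvgr_lt _ fl _ (le_lt_trans l0 e0).
  exists d => // s rs sd sq.
  have : diff_quotient f r s < e.
    apply: hd; rewrite /= ?in_itv /= ?andbT ?gt_eqF //; last lra.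
    by rewrite ltr0_norm; lra.
  rewrite /diff_quotient /GRing.scale /= mulrC ltr_pdivrMr ?subr_gt0 // => h.
  by have := w1 r s pr (ltW rs) sq; lra.
exists (Num.min q (r + d / 2)); first by rewrite lt_min rltq ltrDl divr_gt0.
rewrite ge_min lexx; split=> //; apply: hd; rewrite ?ge_min ?lexx //.
- by rewrite lt_min rltq ltrDl divr_gt0.
- by rewrite gt_min ltrD2l ltr_pdivrMr // mulr_natr mulr2n ltrDl d0 orbT.
Qed.

Lemma open_null_cover (N : set R) (e : R) : measurable N -> mu N = 0%E -> 0 < e ->
  exists U : set R, [/\ open U, N `<=` U & (mu U < e%:E)%E].
Proof.
move=> mN N0 e0; have [|U [oU NU hU]] := lebesgue_regularity_outer mN _ e0.
  by apply: (@le_lt_trans _ _ 0%E); rewrite ?ltry // le_eqVlt; apply/orP; left; apply/eqP.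
exists U; split=> //; have mU := measurable_realfun.open_measurable oU.
rewrite (measureDI mu mU mN) setIC (setIidl NU).
by rewrite [X in (_ + X)%E](_ : _ = 0%E) ?adde0.
Qed.

(** With open sets [U k] containing [N], of measure below [e / 2^(k+1)], let [w s] be the sum over
    [k] of the measures of [U k] within [[p, s]]. Around a point of [N] any prescribed number of the
    [U k] contain a common neighbourhood, so [w] grows there with a slope exceeding the local
    constant [K]. *)
Lemma null_variation_lipschitz V (p q : R) (f : R -> V) :
  (forall t, p <= t < q -> exists K, exists2 d, 0 < d &
     forall s, t < s -> s < t + d -> `|f s - f t| <= K * (s - t)) ->
  null_variation p q f.
Proof.
move=> fL N mN N0 e e0.
have /choice[U hU] (k : nat) : exists U : set R,
    [/\ open U, N `<=` U & (mu U < (e / (2 ^ k.+1)%:R)%:E)%E].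
  by apply: open_null_cover => //; rewrite divr_gt0 // ltr0n expn_gt0.
have mU k : measurable (U k) by apply: measurable_realfun.open_measurable; case: (hU k).
pose nu (D : set R) : \bar R := (\sum_(0 <= k <oo) mu (U k `&` D))%E.
have nu_le D : measurable D -> (nu D <= e%:E)%E.
  move=> mD; apply: le_trans (epsilon_trick0 predT (ltW e0)).
  apply: lee_nneseries => // k _; have [_ _ /ltW/(le_trans _)] := hU k; apply.
  apply: le_measure; rewrite ?inE; last exact: subIsetl.
    exact: measurableI (mU k) mD.
  exact: mU.
have nu_ge0 D : (0 <= nu D)%E by apply: nneseries_ge0.
have nu_fin D : measurable D -> nu D \is a fin_num.
  by move=> mD; rewrite ge0_fin_numE //; apply: le_lt_trans (nu_le D mD) (ltry _).
have nuU D E : measurable D -> measurable E -> D `&` E = set0 ->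
    nu (D `|` E) = (nu D + nu E)%E.
  move=> mD mE DE; rewrite /nu -nneseriesD //; apply: eq_eseriesr => k _.
  have [mD' mE'] := (measurableI _ _ (mU k) mD, measurableI _ _ (mU k) mE).
  rewrite setIUr measureU //.
  by rewrite setIACA setIid DE setI0.
have nu_ge (D : set R) n : measurable D -> (forall k, (k < n)%N -> D `<=` U k) ->
    (n%:R%:E * mu D <= nu D)%E.
  move=> mD DU; apply: le_trans (nneseries_lim_ge n _) => //.
  rewrite (eq_big_nat _ _ (F2 := fun=> mu D)); last first.
    by move=> k /andP[_ kn]; rewrite (setIidr (DU k kn)).
  by rewrite big_const_nat subn0 iter_addr_0 // mule_natl.
pose w s := fine (nu `[p, s]%classic).
have split s t : p <= t -> t <= s -> w s = w t + fine (nu `]t, s]%classic).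
  move=> pt ts; rewrite /w -fineD ?nu_fin //; congr fine.
  rewrite -nuU //; last first.
    by apply/seteqP; split => // x [/=]; rewrite !in_itv /= => /andP[_ ?] /andP[?]; lra.
  congr nu; apply/seteqP; split => x /=; rewrite !in_itv /=.
    by move=> /andP[-> xs]; case: (leP x t) => [|_]; [left | right].
  by move=> [/andP[-> xt]|/andP[tx ->]]; rewrite /= ?andbT; lra.
exists w; split => [s t ps st _||t Nt /andP[pt tq]].
- by rewrite (split t s) // lerDl fine_ge0.
- have : w p >= 0 by rewrite fine_ge0.
  have : w q <= e by rewrite -lee_fin fineK ?nu_le // nu_fin.
  by lra.
have [|K [d d0 fK]] := fL t; first by rewrite pt.
pose n := (Num.trunc `|K|).+1.
have [d' d'0 hd'] : exists2 d', 0 < d' &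
    forall s k, (k < n)%N -> `|t - s| < d' -> U k s.
  elim: n => [|n [d1 d10 h1]]; first by exists 1.
  have [oU NU _] := hU n.
  have [d2 /= d20 h2] := open_nbhs_nbhs (conj oU (NU t Nt)).
  exists (Num.min d1 d2) => [|s k]; first by rewrite lt_min d10.
  rewrite ltnS leq_eqVlt lt_min => /orP[/eqP ->|kn] /andP[h3 h4]; [exact: h2 | exact: h1].
exists (Num.min d d') => [|s ts]; first by rewrite lt_min d0.
rewrite -ltrBlDl lt_min => /andP[sd sd'] sq.
apply: le_trans (fK s ts _) _; first by lra.
rewrite (split s t) ?(ltW ts) // addrAC subrr add0r -lee_fin fineK ?nu_fin //.
apply: le_trans (nu_ge _ n _ _) => //; last first.
  move=> k kn x /=; rewrite in_itv /= => /andP[tx xs].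
  by apply: hd' => //; rewrite ltr0_norm; lra.
rewrite lebesgue_measure_itv /= lte_fin ts -EFinD -EFinM lee_fin.
rewrite ler_wpM2r ?subr_ge0 ?(ltW ts) //.
by apply: le_trans (ler_norm K) _; rewrite ltW // truncnS_gt.
Qed.

(** With [U] open around [N] and of measure below the threshold of absolute continuity, [w s] is the
    variation of [f] over finite families of disjoint intervals lying in [U] and in [[p, s]]. *)
Lemma null_variation_ac V (t0 p q : R) (f : R -> V) : t0 <= p ->
  locally_ac_from t0 f -> null_variation p q f.
Proof.
move=> t0p /(_ q) fac N mN N0 e e0.
have [d d0 hd] := fac e e0.
have [U [oU NU Ud]] := open_null_cover mN N0 d0.
have mU := measurable_realfun.open_measurable oU.
(* Endpoints are indexed by [nat] and cut at [n], so that appending an interval involves no change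
   of ordinal type. *)
pose good (s : R) (n : nat) (u v : nat -> R) :=
  [/\ forall i, (i < n)%N -> p <= u i /\ u i <= v i /\ v i <= s,
      forall i, (i < n)%N -> `]u i, v i[%classic `<=` U
    & forall i j, (i < n)%N -> (j < n)%N -> i != j -> v i <= u j \/ v j <= u i].
pose S s := [set z | exists n u v, good s n u v /\
                     z = \sum_(i < n) `|f (v i) - f (u i)|].
have S0 s : S s 0.
  by exists 0%N, (fun=> 0), (fun=> 0); rewrite big_ord0; split.
have Se s : s <= q -> ubound (S s) e.
  move=> sq _ [n [u [v [[g1 g2 g3] ->]]]]; apply: ltW.
  have tI : trivIset setT (fun i : 'I_n => `]u i, v i[%classic).
    apply/trivIsetP => i j _ _ ij; rewrite -subset0 => x [/=].
    rewrite !in_itv /= => /andP[a1 a2] /andP[a3 a4].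
    by case: (g3 i j (ltn_ord i) (ltn_ord j) ij); lra.
  apply: hd => //.
    by move=> i; have [h1 [h2 h3]] := g1 i (ltn_ord i); split; [lra | split; lra].
  rewrite -lte_fin; apply: le_lt_trans Ud.
  rewrite [leLHS](_ : _ = mu (\big[setU/set0]_(i < n) `]u i, v i[%classic)).
    apply: le_measure; rewrite ?inE //.
    - by apply: bigsetU_measurable.
    - apply: (big_ind (fun X => X `<=` U)) => [x []|X Y XU YU x [/XU|/YU]|i _] //.
      exact: g2.
  rewrite measure_semi_additive_ord //; last exact: bigsetU_measurable.
  rewrite -sumEFin; apply: eq_bigr => i _.
  have [_ [uv _]] := g1 i (ltn_ord i).
  suff h : mu `]u i, v i[%classic = (v i - u i)%:E by exact/esym/h.
  rewrite lebesgue_measure_itv /= lte_fin; case: ltP => // vu.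
  by rewrite (_ : v i = u i) ?subrr //; lra.
have S_sup s : s <= q -> has_sup (S s).
  by move=> sq; split; [exists 0 | exists e; exact: Se].
(* A family up to [t] is extended by the interval from [t] to [s]; on suprema this reads
   [|f s - f t| <= w s - w t]. *)
have S_step s t : p <= t -> t <= s -> s <= q -> `]t, s[%classic `<=` U ->
    forall z, S t z -> S s (z + `|f s - f t|).
  move=> pt ts sq tsU _ [n [u [v [[g1 g2 g3] ->]]]].
  pose u' i := if (i < n)%N then u i else t.
  pose v' i := if (i < n)%N then v i else s.
  exists n.+1, u', v'; split; last first.
    rewrite big_ord_recr /= /u' /v' ltnn; congr (_ + _).
    by apply: eq_bigr => i _; rewrite ltn_ord.
  split=> [i _|i _|i j]; rewrite /u' /v'.
  - case: ltnP => [/g1[? [? ?]]|_]; split=> //; split=> //; lra.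
  - by case: ltnP => [/g2|_].
  - rewrite !ltnS => i_n j_n ij; case: ltnP => i_n'; case: ltnP => j_n'.
    + exact: g3.
    + by have [_ [_ ?]] := g1 i i_n'; left.
    + by have [_ [_ ?]] := g1 j j_n'; right.
    + by move: ij; rewrite (@anti_leq i n) ?i_n // (@anti_leq j n) ?j_n ?eqxx.
have S_mono s t : s <= t -> S s `<=` S t.
  move=> st _ [n [u [v [[g1 g2 g3] ->]]]]; exists n, u, v; split=> //; split=> //.
  by move=> i /g1[? [? ?]]; split=> //; split=> //; lra.
exists (fun s => sup (S s)); split => [s t ps st tq||t Nt /andP[pt tq]].
- apply: ge_sup; first by exists 0.
  by move=> z /(S_mono _ _ st); apply: ub_le_sup; case: (S_sup t tq).
- apply: (@le_trans _ _ (sup (S q))).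
    rewrite lerBlDr lerDl; apply: ub_le_sup; last exact: S0.
    have [tq|qt] := leP p q; first by case: (S_sup p tq).
    exists 0 => _ [n [u [v [[g1 _ _] ->]]]].
    rewrite big1 // => i _; have [h1 [h2 h3]] := g1 i (ltn_ord i).
    by rewrite (_ : v i = u i) ?subrr ?normr0 //; lra.
  by apply: ge_sup; [exists 0 | exact: Se].
have [r /= r0 hr] := open_nbhs_nbhs (conj oU (NU t Nt)).
exists r => // s ts sr sq; rewrite lerBrDr.
rewrite -lerBrDl; apply: ge_sup; first by exists 0.
move=> z Sz; rewrite lerBrDl; apply: ub_le_sup; first by case: (S_sup s sq).
rewrite addrC; apply: S_step => //; first exact: ltW.
by move=> x /=; rewrite in_itv /= => /andP[tx xs]; apply: hr; rewrite /= ltr0_norm; lra.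
Qed.

End NullVariation.

(** * A class of functions stable under the operations forming the energy *)

Section Tame.
Context {R : realType} (t0 : R).
Implicit Types (V W : normedModType R) (p q t : R).

(** Continuity is required for the supremum argument behind monotonicity, and it gives the bounds on
    segments that products need. *)
Definition tame V (f : R -> V) :=
  {within `[t0, +oo[, continuous f} /\
  forall p q, t0 <= p -> p <= q -> null_variation p q f.

(** Weaker than derivability: a residual inherits it from its arguments even where it has no
    derivative. *)
Definition point_lipschitz V (f : R -> V) t := exists K, exists2 d, 0 < d &
  forall s, t0 <= s -> `|s - t| < d -> `|f s - f t| <= K * `|s - t|.

Lemma point_lipschitz_deriv V (f : R -> V) t :
  derivable_from t0 f t -> point_lipschitz f t.
Proof.
move=> /derivable_fromP; set l := deriv_from _ _ _ => fl.
have /within_rayP[d d0 hd] : \forall s \near within `[t0, +oo[ (nbhs t),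
    `|f s - f t| <= (`|l| + 1) * `|s - t|.
  apply: within_dray; last by rewrite !subrr !normr0 mulr0.
  near=> s; have st : s - t != 0 by near: s; exact: ray_neq.
  have : `|diff_quotient f t s| < `|l| + 1.
    by near: s; apply: (cvgr_norm_lt l) => //; rewrite ltrDl.
  rewrite normrZ normfV mulrC ltr_pdivrMr ?normr_gt0 //; exact: ltW.
by exists (`|l| + 1), d.
Unshelve. all: by end_near. Qed.

Lemma tame_lipschitz V (f : R -> V) :
  (forall t, t0 <= t -> point_lipschitz f t) -> tame f.
Proof.
move=> fL; split=> [|p q t0p pq].
  apply/subspace_continuousP => t; rewrite /= in_itv /= andbT => t0t.
  apply/cvgrPdist_lt => e e0; have [K [d d0 hd]] := fL t t0t.
  have K0 : 0 < `|K| + 1 by rewrite ltr_wpDl.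
  apply/within_rayP; exists (Num.min d (e / (`|K| + 1))).
    by rewrite lt_min d0 divr_gt0.
  move=> s t0s; rewrite lt_min ltr_pdivlMr // => /andP[sd se].
  rewrite distrC; apply: le_lt_trans (hd s t0s sd) (le_lt_trans _ se).
  by rewrite mulrC ler_wpM2l //; have := ler_norm K; lra.
apply: null_variation_lipschitz => t /andP[pt tq].
have [|K [d d0 hd]] := fL t; first exact: le_trans pt.
exists K, d => // s ts sd; rewrite -(gtr0_norm (_ : 0 < s - t)) ?subr_gt0 //.
by apply: hd; [lra | rewrite gtr0_norm; lra].
Qed.

Lemma tame_deriv V (f : R -> V) : differentiable_from t0 f -> tame f.
Proof. by move=> fd; apply: tame_lipschitz => t /fd /point_lipschitz_deriv. Qed.

Lemma tame_ac V (f : R -> V) : {within `[t0, +oo[, continuous f} ->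
  locally_ac_from t0 f -> tame f.
Proof. by move=> fc fac; split=> // p q t0p _; exact: null_variation_ac fac. Qed.

Lemma tame_cst V (k : V) : tame (fun=> k).
Proof.
apply: tame_lipschitz => t _; exists 0, 1 => // s _ _.
by rewrite subrr normr0 mul0r.
Qed.

Lemma tame_bounded V (f : R -> V) p q : t0 <= p -> tame f ->
  exists2 M, 0 <= M & forall t, p <= t <= q -> `|f t| <= M.
Proof.
move=> t0p [fc _].
have fc' : {within `[p, q], continuous f}.
  apply: continuous_subspaceW fc => x /=; rewrite !in_itv /= andbT => /andP[px _].
  exact: le_trans px.
have [M [_ hM]] := compact_bounded (continuous_compact fc' (@segment_compact R p q)).
exists (`|M| + 1) => [|t pt]; first by rewrite addr_ge0.
apply: hM; first by have := ler_norm M; lra.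
by exists t => //=; rewrite in_itv.
Qed.

Lemma tame_comp V W (U : normedModType R) (f : R -> V) (g : R -> W) (h : R -> U) :
  {within `[t0, +oo[, continuous h} ->
  (forall p q, t0 <= p -> p <= q -> exists M, forall s t, p <= s <= q -> p <= t <= q ->
     `|h s - h t| <= M * (`|f s - f t| + `|g s - g t|)) ->
  tame f -> tame g -> tame h.
Proof.
move=> hc hM [_ fn] [_ gn]; split=> // p q t0p pq.
by have [M {}hM] := hM p q t0p pq; apply: null_variation_comp hM _ _; auto.
Qed.

Lemma tameD V (f g : R -> V) : tame f -> tame g -> tame (fun t => f t + g t).
Proof.
move=> ft gt; apply: tame_comp (ft) (gt).
  by move=> t; apply: cvgD; [apply: ft.1 | apply: gt.1].
move=> p q _ _; exists 1 => s t _ _.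
by rewrite mul1r opprD addrACA; exact: ler_normD.
Qed.

Lemma tameZ V (f : R -> R) (g : R -> V) : tame f -> tame g ->
  tame (fun t => f t *: g t).
Proof.
move=> ft gt; apply: tame_comp (ft) (gt).
  by move=> t; apply: cvgZ; [apply: ft.1 | apply: gt.1].
move=> p q t0p _; have [M M0 hM] := tame_bounded q t0p ft.
have [K K0 hK] := tame_bounded q t0p gt.
exists (M + K) => s t sp tp.
have -> : f s *: g s - f t *: g t = f s *: (g s - g t) + (f s - f t) *: g t.
  by rewrite scalerBr scalerBl subrKA.
apply: le_trans (ler_normD _ _) _; rewrite !normrZ.
have h1 := ler_wpM2r (normr_ge0 (g s - g t)) (hM s sp).
have h2 := ler_wpM2l (normr_ge0 (f s - f t)) (hK t tp).
have h3 := mulr_ge0 M0 (normr_ge0 (f s - f t)).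
have h4 := mulr_ge0 K0 (normr_ge0 (g s - g t)).
lra.
Qed.

Lemma tame_scale V (c : R) (f : R -> V) : tame f -> tame (fun t => c *: f t).
Proof. exact: tameZ (tame_cst c). Qed.

Lemma tameB V (f g : R -> V) : tame f -> tame g -> tame (fun t => f t - g t).
Proof.
move=> ft gt; have := tameD ft (tame_scale (-1) gt).
by under eq_fun do rewrite scaleN1r.
Qed.

Lemma tame_normsq V (f : R -> V) : tame f -> tame (fun t => `|f t| ^+ 2).
Proof.
move=> ft; apply: tame_comp (ft) (ft).
  rewrite (_ : (fun t => `|f t| ^+ 2) = (fun t => `|f t| * `|f t|)); last first.
    by apply/funext => s; rewrite expr2.
  by move=> t; apply: cvgM; apply: cvg_norm; apply: ft.1.
move=> p q t0p _; have [M M0 hM] := tame_bounded q t0p ft.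
exists M => s t sp tp; rewrite subr_sqr normrM mulrC.
rewrite -mulr2n -[X in _ <= _ * X]mulr_natl mulrA.
apply: ler_pM => //; last exact: ler_dist_dist.
rewrite ger0_norm ?addr_ge0 //; have := hM s sp; have := hM t tp; lra.
Qed.

Lemma nonincreasing_tame (f : R -> R) t1 : t0 <= t1 -> tame f ->
  (ae_from t1 (fun t => exists2 l, l <= 0 & has_deriv_from t0 f t l)) ->
  forall p q, t1 <= p -> p <= q -> f q <= f p.
Proof.
move=> t01 ft fd p q t1p pq; have t0p := le_trans t01 t1p.
apply: nonincreasing_of_deriv_le0 t0p pq ft.1 (ft.2 p q t0p pq) _.
have FF := ae_filter_ringOfSetsType (@lebesgue_measure R).
by apply: (@filterS _ _ FF _ _ _ fd) => t ht pt; apply: ht; exact: le_trans pt.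
Qed.

(* With L as a new time variable, h is Lipschitz from below and integrable. *)
Lemma barbalat (L E h : R -> R) (t1 C k : R) : t0 <= t1 -> 0 < C -> 0 < k ->
  tame L -> tame E -> tame h ->
  L t @[t --> +oo] --> +oo ->
  (forall t, t1 <= t -> 0 <= E t) -> (forall t, t1 <= t -> 0 <= h t) ->
  ae_from t1 (fun t => exists lL lE lh,
    [/\ has_deriv_from t0 L t lL /\ 0 <= lL,
        has_deriv_from t0 E t lE /\ lE <= - (k * (h t * lL))
      & has_deriv_from t0 h t lh /\ - (C * lL) <= lh]) ->
  h t @[t --> +oo] --> 0.
Proof.
move=> t01 C0 k0 tL tE th Loo E0 h0 hd.
have FF := ae_filter_ringOfSetsType (@lebesgue_measure R).
have E_mono p q : t1 <= p -> p <= q -> E q <= E p.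
  apply: nonincreasing_tame => //; apply: (@filterS _ _ FF _ _ _ hd) => t + t1t.
  move=> /(_ t1t)[lL [lE [lh [[_ lL0] [hE lEk] _]]]]; exists lE => //.
  by apply: le_trans lEk _; rewrite oppr_le0 !mulr_ge0 ?h0 // ltW.
have hL_mono p q : t1 <= p -> p <= q -> h p - C * (L q - L p) <= h q.
  move=> t1p pq; suff : - h q - C * L q <= - h p - C * L p by lra.
  pose f s := - 1 *: h s - C *: L s.
  suff : f q <= f p by rewrite /f !scaleN1r.
  apply: (@nonincreasing_tame f t1) => //.
    by apply: tameB; apply: tame_scale.
  apply: (@filterS _ _ FF _ _ _ hd) => t + t1t.
  move=> /(_ t1t)[lL [lE [lh [[hL lL0] _ [hh lhC]]]]].
  exists (- 1 *: lh - C *: lL); last by apply: has_derivB; exact: has_deriv_scale.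
  by rewrite scaleN1r /GRing.scale /=; lra.
have E_inf : has_inf [set E t | t in [set t | t1 <= t]].
  split; first by exists (E t1), t1 => //=.
  by exists 0 => _ [t t1t <-]; exact: E0.
apply/cvgrPdist_lt => e e0.
(* If [h p >= e], then [h >= e - C l] after a lapse [l] of [L]; up to [l = e / (2 * C)] this costs
   [E] at least [3 d / 2], while less than [d] is left beyond [T]. *)
pose d := k * e ^+ 2 / (4 * C).
have d0 : 0 < d by rewrite divr_gt0 ?mulr_gt0 ?exprn_gt0.
have [_ [T /= t1T <-] ET] := inf_adherent d0 E_inf.
exists T; split; first exact: num_real.
move=> p Tp; rewrite sub0r normrN.
have t1p : t1 <= p by lra.
rewrite ger0_norm ?h0 // ltNge; apply/negP => ehp.
have [q [pq Lq]] : exists q, p <= q /\ L q - L p = e / (2 * C).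
  have [q1 [_ hq1]] := proj1 (cvgryPge _) Loo (L p + e / (2 * C)).
  pose q2 := Num.max p (q1 + 1).
  have pq2 : p <= q2 by rewrite le_max lexx.
  have Lq2 : L p + e / (2 * C) <= L q2.
    by apply: hq1; rewrite lt_max ltrDl ltr01 orbT.
  have e2 : 0 < e / (2 * C) by rewrite divr_gt0 ?mulr_gt0.
  have [||c cpq Lc] := @IVT _ L p q2 (L p + e / (2 * C)) pq2.
  - apply: continuous_subspaceW tL.1 => x /=; rewrite !in_itv /= andbT => /andP[px _].
    by lra.
  - by rewrite ge_min le_max Lq2 orbT andbT lerDl ltW.
  exists c; move: cpq; rewrite in_itv /= => /andP[-> _]; split=> //.
  by rewrite Lc addrAC subrr add0r.
have t0p := le_trans t01 t1p.
pose l s := L s - L p.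
(* To [E] is added its guaranteed loss, the primitive of [k (e - C l)] in the variable [l]. *)
pose f s := E s + k *: (e *: l s - (C / 2) *: (l s *: l s)).
have lt : tame l by apply: tameB => //; exact: tame_cst.
have : f q <= f p.
  apply: (@nonincreasing_tame f p) => //.
    apply: tameD => //; apply/tame_scale/tameB; apply: tame_scale => //.
    exact: tameZ.
  apply: (@filterS _ _ FF _ _ _ hd) => s + ps.
  have t1s : t1 <= s by lra.
  move=> /(_ t1s)[lL [lE [lh [[hL lL0] [hE lEk] _]]]].
  exists (lE + k *: (e *: (lL - 0) - (C / 2) *: (l s *: (lL - 0) + (lL - 0) *: l s))).
    have := hL_mono p s t1p ps; rewrite /GRing.scale /= subr0 -/(l s) => hs.
    have : e - C * l s <= h s by lra.
    move=> /(ler_wpM2r lL0)/(ler_wpM2l (ltW k0)); lra.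
  have hl : has_deriv_from t0 l s (lL - 0) by apply: has_derivB => //; exact: has_deriv_cst.
  apply: has_derivD => //; apply/has_deriv_scale/has_derivB; apply: has_deriv_scale => //.
  exact: has_derivZ.
rewrite /f /l Lq subrr /GRing.scale /= => fqp.
have EpT := E_mono T p t1T (ltW Tp).
have Eq : inf [set E t | t in [set t | t1 <= t]] <= E q.
  by apply: ge_inf; [case: E_inf | exists q => //=; lra].
have C1 : C * (e / (2 * C)) = e / 2 by field; rewrite gt_eqF.
have dE : k * (e * (e / (2 * C))) = 2 * d by rewrite /d; field; rewrite gt_eqF.
have dE' : k * (C / 2 * (e / (2 * C) * (e / (2 * C)))) = d / 2.
  by rewrite /d; field; rewrite gt_eqF.
by move: fqp; rewrite mulrBr dE dE' -/d in ET *; lra.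
Qed.

End Tame.

(** * Derivatives of inverses, logarithms and norms, and bounds on derivatives *)

Section MoreDerivatives.
Context {R : realType} (t0 : R).

Lemma has_derivV (f : R -> R) (t l : R) : f t != 0 -> has_deriv_from t0 f t l ->
  has_deriv_from t0 (fun s => (f s)^-1) t (- (f t) ^- 2 * l).
Proof.
move=> ft fl; apply: (has_deriv_comp (g := fun y => y^-1)) fl.
by have := is_deriveV ft (is_derive_id (f t) 1); rewrite /GRing.scale /= mulr1.
Qed.

Lemma has_deriv_ln (f : R -> R) (t l : R) : 0 < f t -> has_deriv_from t0 f t l ->
  has_deriv_from t0 (fun s => ln (f s)) t (l / f t).
Proof.
by move=> ft fl; rewrite mulrC; apply: (has_deriv_comp _ fl); exact: is_derive1_ln.
Qed.

Lemma has_deriv_normsq (H : completeNormedModType R) (ip : H -> H -> R)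
    (f : R -> H) (t : R) (l : H) : inner_product ip -> has_deriv_from t0 f t l ->
  has_deriv_from t0 (fun s => `|f s| ^+ 2) t (2 * ip (f t) l).
Proof.
move=> ip_inner fl.
have h : ip (f s + f t) (diff_quotient f t s) @[s --> within `[t0, +oo[ t^']
    --> 2 * ip (f t) l.
  have -> : 2 * ip (f t) l = ip (f t + f t) l by rewrite (ipDl ip_inner) mulr_natl.
  apply: cvg_ip => //; apply: cvgD; [exact: has_deriv_cvg fl | exact: cvg_cst].
refine (near_cvg _ h); apply: nearW => s.
rewrite /diff_quotient (ipZr ip_inner) /GRing.scale /= !(ipE ip_inner).
by rewrite (ipC ip_inner (f t) (f s)); congr (_ * _); ring.
Qed.

(** A bound on increments passes to the limit of difference quotients; it is meant for
    [residual_step]. *)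
Lemma has_deriv_norm_le (V W U : normedModType R) (f : R -> V) (g : R -> W) (h : R -> U)
    (t M K : R) l k m : t0 <= t ->
  has_deriv_from t0 f t l -> has_deriv_from t0 g t k -> has_deriv_from t0 h t m ->
  (forall s, t0 <= s -> `|f s - f t| <= M * `|g s - g t| + K * `|h s - h t|) ->
  `|l| <= M * `|k| + K * `|m|.
Proof.
move=> t0t fl gk hm fgh; have PF := ray_proper t0t.
have c1 : `|diff_quotient f t s| @[s --> within `[t0, +oo[ t^'] --> `|l|.
  exact: cvg_norm.
have c2 : M * `|diff_quotient g t s| + K * `|diff_quotient h t s|
    @[s --> within `[t0, +oo[ t^'] --> M * `|k| + K * `|m|.
  by apply: cvgD; apply: cvgM; by [exact: cvg_cst | exact: cvg_norm].
apply: ler_cvg_to c1 c2 _; exists 1 => //= s _ _; rewrite in_itv /= andbT => t0s.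
rewrite !normrZ.
rewrite [X in _ <= X](_ : _ = `|(s - t)^-1| * (M * `|g s - g t| + K * `|h s - h t|)).
  by rewrite ler_wpM2l // fgh.
by ring.
Qed.

End MoreDerivatives.

(** * Asymptotic and almost everywhere statements *)

Section Landau.
Context {R : realType}.

Lemma eqO_bound {T : pointedType} {V W : normedModType R} (F : filter_on T)
    (f : T -> V) (g : T -> W) (C : R) :
  (\forall t \near F, `|f t| <= C * `|g t|) -> f =O_F g.
Proof.
move=> fg; apply/eqO_exP; exists (`|C| + 1); first by rewrite ltr_wpDl.
apply: filterS fg => t /le_trans; apply; rewrite ler_wpM2r //.
by have := ler_norm C; lra.
Qed.

Lemma eqO_boundP {T : pointedType} {V W : normedModType R} (F : filter_on T)
    (f : T -> V) (g : T -> W) : f =O_F g ->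
  exists2 C, 0 < C & \forall t \near F, `|f t| <= C * `|g t|.
Proof. by move=> /eqO_exP. Qed.

Lemma sqr_norm_cvg0 (V : normedModType R) (f : R -> V) :
  `|f t| ^+ 2 @[t --> +oo] --> (0 : R) ->
  forall e, 0 < e -> \forall t \near +oo, `|f t| <= e.
Proof.
move=> /cvgrPdist_lt f0 e e0; apply: filterS (f0 _ (exprn_gt0 2 e0)) => t.
rewrite sub0r normrN ger0_norm ?exprn_ge0 // => /ltW.
by rewrite ler_sqr ?nnegrE ?(ltW e0).
Qed.

Lemma ereal_inf_gt0P (t0 : R) (f : R -> R) :
  (0 < ereal_inf [set (f t)%:E | t in `[t0, +oo[])%E ->
  exists2 k, 0 < k & forall t, t0 <= t -> k <= f t.
Proof.
set i := ereal_inf _ => i0.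
have fi t : t0 <= t -> (i <= (f t)%:E)%E.
  by move=> t0t; apply: ereal_inf_lbound; exists t => //=; rewrite in_itv /= t0t.
move: i i0 fi => [r| |] // r0 fi.
- by exists r.
- by have := fi t0 (lexx _); rewrite leye_eq.
Qed.

Lemma ereal_sup_ltyP (t0 : R) (f : R -> R) :
  (ereal_sup [set (f t)%:E | t in `[t0, +oo[] < +oo)%E ->
  exists M, forall t, t0 <= t -> f t <= M.
Proof.
set i := ereal_sup _ => i0.
have fi t : t0 <= t -> ((f t)%:E <= i)%E.
  by move=> t0t; apply: ereal_sup_ubound; exists t => //=; rewrite in_itv /= t0t.
move: i i0 fi => [r| |] // r0 fi.
- by exists r.
- by have := fi t0 (lexx _); rewrite leeNy_eq.
Qed.

Lemma limf_einf_gt0P (f : R -> R) : (0 < limf_einf (fun t => (f t)%:E) +oo_R)%E ->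
  exists2 k, 0 < k & \forall t \near +oo, k <= f t.
Proof.
rewrite limf_einfE => /ereal_sup_gt[_ [V FV <-]]; set i := ereal_inf _ => i0.
have fi t : V t -> (i <= (f t)%:E)%E.
  by move=> Vt; apply: ereal_inf_lbound; exists t.
move: i i0 fi => [r| |] // r0 fi.
- by exists r => //; apply: filterS FV => t /fi.
- exists 1 => //; apply: filterS FV => t /fi; by rewrite leye_eq.
Qed.

Lemma pinfty_from (t0 : R) (P : R -> Prop) : (\forall t \near +oo, P t) ->
  exists2 t1, t0 <= t1 & forall t, t1 <= t -> P t.
Proof.
move=> [M [_ hM]]; exists (Num.max t0 (M + 1)); first by rewrite le_max lexx.
by move=> t; rewrite ge_max => /andP[_ Mt]; apply: hM; lra.
Qed.

Lemma ae_pinfty_near (P : R -> Prop) : (\forall t \near +oo, P t) -> ae_pinfty P.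
Proof.
move=> [M [_ hM]]; exists (M + 1).
have FF := ae_filter_ringOfSetsType (@lebesgue_measure R).
by apply: (@nearW _ _ _ FF) => t Mt; apply: hM; lra.
Qed.

Lemma ae_from_near (t0 : R) (P : R -> Prop) : (forall t, t0 <= t -> P t) -> ae_from t0 P.
Proof.
move=> h; have FF := ae_filter_ringOfSetsType (@lebesgue_measure R).
exact: (@nearW _ _ _ FF).
Qed.

Lemma ae_fromI (t0 : R) (P Q : R -> Prop) :
  ae_from t0 P -> ae_from t0 Q -> ae_from t0 (fun t => P t /\ Q t).
Proof.
have FF := ae_filter_ringOfSetsType (@lebesgue_measure R).
by move=> hP hQ; apply: (@filterS2 _ _ FF _ _ _ _ hP hQ) => t Pt Qt t0t; split; auto.
Qed.

Lemma ae_fromS (t0 t1 : R) (P Q : R -> Prop) : t0 <= t1 ->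
  (forall t, t1 <= t -> P t -> Q t) -> ae_from t0 P -> ae_from t1 Q.
Proof.
have FF := ae_filter_ringOfSetsType (@lebesgue_measure R).
move=> t01 PQ hP; apply: (@filterS _ _ FF _ _ _ hP) => t Pt t1t.
by apply: PQ => //; apply: Pt; exact: le_trans t1t.
Qed.

End Landau.

(** * Dissipation of the energy *)

Section Energy.
Context {R : realType} {H : completeNormedModType R} {ip : H -> H -> R}.
Hypothesis ip_inner : inner_product ip.

(** The auxiliary functions are coefficients of this derivative: [- aux_Wv] of [|v|^2], [- aux_Q1]
    of [<x - xs, T>] and [- aux_Q2] of [<v, T>]. *)
Lemma energy_dissipation (t0 t : R) (Lambda alpha beta b a m c : R -> R)
    (x T : R -> H) (xs : H) (dx := deriv_from t0 x)
    (v := fun s => dx s + beta s *: T s)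
    (u := fun s => a s *: (x s - xs) + m s *: v s) :
  t0 <= t -> derivable_from t0 x t -> derivable_from t0 dx t ->
  derivable_from t0 T t -> derivable_from t0 beta t ->
  derivable_from t0 a t -> derivable_from t0 m t -> derivable_from t0 c t ->
  deriv_from t0 dx t + alpha t *: dx t + beta t *: deriv_from t0 T t + b t *: T t = 0 ->
  m t * deriv_from t0 a t + a t * (a t + deriv_from t0 m t - m t * alpha t) + c t = 0 ->
  a t * deriv_from t0 a t + 2^-1 * deriv_from t0 c t <= 0 ->
  0 < Lambda t -> Lambda t * `|T t| ^+ 2 <= ip (x t - xs) (T t) ->
  0 < aux_Wv t0 alpha a m t -> 0 < aux_WT t0 Lambda alpha beta b a m c t ->
  exists2 l,
    has_deriv_from t0
      (fun s => 2^-1 *: `|u s| ^+ 2 + 2^-1 *: (c s *: `|x s - xs| ^+ 2)) t l &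
    l <= - (2^-1 * aux_Wv t0 alpha a m t * `|v t| ^+ 2
            + aux_WT t0 Lambda alpha beta b a m c t * `|T t| ^+ 2).
Proof.
move=> t0t /derivable_fromP hx /derivable_fromP hdx /derivable_fromP hT
  /derivable_fromP hb /derivable_fromP ha /derivable_fromP hm /derivable_fromP hc.
rewrite /aux_WT /aux_Q1 /aux_Q2 /aux_K /aux_Wv.
move: (deriv_from t0 dx t) (deriv_from t0 T t) (deriv_from t0 beta t) (deriv_from t0 a t)
  (deriv_from t0 m t) (deriv_from t0 c t) hdx hT hb ha hm hc.
move=> ddx dT db da dm dc hdx hT hb ha hm hc ode eq1 le1 L0 coco.
have hy : has_deriv_from t0 (fun s => x s - xs) t (dx t).
  by rewrite -[dx t]subr0; apply: has_derivB => //; exact: has_deriv_cst.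
have hv := has_derivD hdx (has_derivZ hb hT).
have hu := has_derivD (has_derivZ ha hy) (has_derivZ hm hv).
have hE := has_derivD (has_deriv_scale (c := 2^-1) (has_deriv_normsq ip_inner hu))
  (has_deriv_scale (c := 2^-1) (has_derivZ hc (has_deriv_normsq ip_inner hy))).
move=> Wv0 WT0; eexists; first exact: hE.
have ddxE : ddx = - (alpha t *: (v t - beta t *: T t) + beta t *: dT + b t *: T t).
  by apply/eqP; rewrite -addr_eq0 /v addrK !addrA ode.
have dxE : dx t = v t - beta t *: T t by rewrite addrK.
rewrite /u -/(v t) ddxE dxE {ddxE dxE ode hE hu hv hy hdx hT hb ha hm hc}.
move: Wv0 WT0 coco eq1 le1 L0.
move: (x t - xs) (v t) (T t) (a t) (m t) (c t) (beta t) (b t) (alpha t) (Lambda t).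
move=> y w T' a' m' c' beta' b' alpha' L Wv0 WT0 coco eq1 le1 L0.
set Wv := (- m' * _) in Wv0 WT0 *; set Q2 := m' * (_ + _) in WT0 *.
set Q1 := _ + c' * beta' in WT0 *.
pose S := a' * da + 2^-1 * dc.
rewrite [leLHS](_ : _ = S * ip y y - Wv * ip w w - Q1 * ip y T' - Q2 * ip w T'
  + (m' * da + a' * (a' + dm - m' * alpha') + c') * ip y w); last first.
  rewrite /GRing.scale /= !(ipE ip_inner) (ipC ip_inner w y).
  by rewrite /S /Wv /Q1 /Q2; field.
have h1 : S * ip y y <= 0 by rewrite mulr_le0_ge0 // ip_ge0.
have q0 : 0 <= Q2 ^+ 2 / (2 * Wv) by rewrite divr_ge0 ?exprn_even_ge0 // mulr_ge0 // ltW.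
(* The quotient subtracted in [WT0] is nonnegative, so [Q1] times [Lambda] is positive; this sign
   lets [Q1] multiply the cocoercivity inequality. *)
have Q1_gt0 : 0 < Q1 by rewrite -(pmulr_lgt0 _ L0); lra.
have h2 := ler_wpM2l (ltW Q1_gt0) coco.
(* Young's inequality: half of the velocity dissipation absorbs the cross term, at the price of the
   quotient subtracted in [aux_WT]. *)
have h3 : - (Q2 * ip w T') <= 2^-1 * Wv * ip w w + Q2 ^+ 2 / (2 * Wv) * ip T' T'.
  have W2 : 0 < 2 * Wv by rewrite mulr_gt0.
  rewrite -(ler_pM2l W2) mulrDr [X in _ <= _ + X](_ : _ = Q2 ^+ 2 * ip T' T'); last first.
    by field; rewrite gt_eqF.
  have := ip_ge0 ip_inner (Wv *: w + Q2 *: T').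
  by rewrite !(ipE ip_inner) (ipC ip_inner T' w); lra.
move: h2; rewrite eq1 mul0r !(ip_norm ip_inner); lra.
Qed.

End Energy.

Theorem theorem4p2 (R : realType) (H : completeNormedModType R)
  (ip : H -> H -> R) (ip_inner : inner_product ip)
  (t0 rho nu : R) (A : H -> set H) (B : H -> H)
  (A_max : maximal_comonotone ip rho A)
  (nu_gt0 : 0 < nu) (B_coco : cocoercive ip nu B)
  (lambda gamma delta theta phi psi : R -> R)
  (lambda_C1 : C1_from t0 lambda) (gamma_C1 : C1_from t0 gamma)
  (delta_C1 : C1_from t0 delta) (theta_C1 : C1_from t0 theta)
  (phi_C1 : C1_from t0 phi) (psi_C1 : C1_from t0 psi)
  (lambda_gt0 : forall t, t0 <= t -> 0 < lambda t)
  (delta_gt0 : forall t, t0 <= t -> 0 < delta t)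
  (theta_01 : forall t, t0 <= t -> 0 <= theta t <= 1)
  (phi_ge0 : forall t, t0 <= t -> 0 <= phi t)
  (psi_ge0 : forall t, t0 <= t -> 0 <= psi t)
  (gmin gmax : R)
  (gmin_gt : Num.max 0 (- 2 * rho) < gmin) (gmax_lt : gmax < 2 * nu)
  (gamma_bnd : forall t, t0 <= t -> gmin <= gamma t <= gmax)
  (Lambda := coef_Lambda rho nu lambda gamma)
  (inf_Lambda : (0 < ereal_inf [set (Lambda t)%:E | t in `[t0, +oo[])%E)
  (zer_neq0 : zer (op_add A B) !=set0)
  (Gamma := coef_Gamma theta phi psi)
  (Gamma_lt1 : forall t, t0 <= t -> Gamma t < 1)
  (alpha := coef_alpha t0 delta theta phi psi)
  (beta := coef_beta lambda theta phi psi)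
  (b := coef_b t0 lambda delta theta phi psi)
  (alpha_gt0 : forall t, t0 <= t -> 0 < alpha t)
  (b_ge0 : forall t, t0 <= t -> 0 <= b t)
  (beta_gt0 : forall t, t0 <= t -> 0 < beta t)
  (alpha_loc : locally_integrable_from t0 alpha)
  (b_loc : locally_integrable_from t0 b)
  (beta_ac : locally_ac_from t0 beta)
  (x : R -> H)
  (Tx := fun t => splitting (lambda t) (gamma t) A B (x t))
  (x_sol : strong_global_solution t0 alpha beta b Tx x)
  (a m c : R -> R)
  (a_gt0 : forall t, t0 <= t -> 0 < a t)
  (m_gt0 : forall t, t0 <= t -> 0 < m t)
  (c_gt0 : forall t, t0 <= t -> 0 < c t)
  (a_cont : {within `[t0, +oo[, continuous a})
  (m_cont : {within `[t0, +oo[, continuous m})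
  (c_cont : {within `[t0, +oo[, continuous c})
  (a_diff : differentiable_from t0 a)
  (m_diff : differentiable_from t0 m)
  (c_diff : differentiable_from t0 c)
  (dx := deriv_from t0 x)
  (da := deriv_from t0 a) (dm := deriv_from t0 m) (dc := deriv_from t0 c)
  (dgamma := deriv_from t0 gamma) (dlambda := deriv_from t0 lambda)
  (Wv := aux_Wv t0 alpha a m)
  (WT := aux_WT t0 Lambda alpha beta b a m c)
  (param_eq : ae_from t0 (fun t =>
     m t * da t + a t * (a t + dm t - m t * alpha t) + c t = 0))
  (W_gt0 : ae_from t0 (fun t => 0 < Wv t /\ 0 < WT t))
  (param_le : ae_from t0 (fun t => a t * da t + 2^-1 * dc t <= 0))
  (inf_c : (0 < ereal_inf [set (c t)%:E | t in `[t0, +oo[])%E)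
  (Yx := fun t => yosida (gamma t) A (x t - gamma t *: B (x t)) + B (x t))
  (hyp1 := [/\
     (ereal_sup [set (a t)%:E | t in `[t0, +oo[] < +oo)%E
   & (ereal_sup [set (m t * beta t / lambda t)%:E | t in `[t0, +oo[] < +oo)%E])
  (hyp2 := [/\
     (exists m1 m2 : R, 0 < m1 /\ forall t, t0 <= t -> m1 <= dm t <= m2),
     (forall t, t0 <= t -> dm t <= m t),
     (0 < ereal_inf [set (gamma t)%:E | t in `[t0, +oo[])%E,
     (fun t => `|dgamma t| / gamma t) =O_+oo (fun t => dm t / m t)
   & (fun t => `|dlambda t| / lambda t) =O_+oo (fun t => dm t / m t)])
  (hyp3 := exists Cb Cl Cv CT : R,
     [/\ [/\ 0 < Cb, 0 < Cl, 0 < Cv & 0 < CT],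
         [/\ alpha =O_+oo (fun t => dm t / m t),
             beta =O_+oo (fun t => m t / dm t),
             b =O_+oo (fun=> 1 : R)
           & forall t, t0 <= t -> b t ^+ 2 <= Cb * (dm t * WT t / m t ^+ 3)],
         (forall t, t0 <= t -> Cl * m t ^+ 2 <= lambda t),
         (forall t, t0 <= t ->
            Cv * (m t * dm t) <= Wv t /\ CT * (m t ^+ 2 * dm t) <= WT t)
       & (0 < limf_einf (fun t => (m t * WT t / (dm t * lambda t ^+ 2))%:E)
                        +oo_R)%E]) :
  (hyp1 ->
     (fun t => `|Tx t|) =O_+oo (fun t => (lambda t)^-1) /\
     (fun t => `|dx t|) =O_+oo (fun t => (m t)^-1)) /\
  (hyp1 -> hyp2 ->
     ae_pinfty (derivable_from t0 Tx) /\
     (fun t => `|deriv_from t0 Tx t|)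
       =O_ae_pinfty (fun t => dm t / (m t * lambda t))) /\
  (hyp1 -> hyp2 -> hyp3 ->
     [/\ ae_pinfty (derivable_from t0 dx) /\
         (fun t => `|deriv_from t0 dx t|)
           =O_ae_pinfty (fun t => dm t / m t ^+ 2),
         (fun t => `|dx t|) =o_+oo (fun t => (m t)^-1),
         (fun t => `|Tx t|) =o_+oo (fun t => (lambda t)^-1),
         (fun t => `|Yx t|) =o_+oo (fun t => (gamma t)^-1)
       & ae_pinfty (derivable_from t0 Yx) /\
         exists u w : R -> R,
           [/\ u =O_ae_pinfty (fun t => dm t / (m t * gamma t)),
               w =o_ae_pinfty (fun t =>
                 lambda t * `|deriv_from t0 (fun s => gamma s / lambda s) t|
                 / gamma t ^+ 2)
             & ae_pinfty (fun t => `|deriv_from t0 Yx t| = u t + w t)]]).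

Proof.

(* The residual along the trajectory *)
have [x_d [x_c dx_c] [x_ac dx_ac] ode] := x_sol.
have [gmin0 gmin1] : 0 < gmin /\ - 2 * rho < gmin.
  by apply/andP; rewrite -gt_max.
have g0 t : t0 <= t -> 0 < gamma t by move=> /gamma_bnd/andP[h _]; lra.
have g1 t : t0 <= t -> 0 < gamma t + 2 * rho by move=> /gamma_bnd/andP[h _]; lra.
have g2 t : t0 <= t -> gamma t <= 2 * nu by move=> /gamma_bnd/andP[_ h]; lra.
have [xs zs] := zer_neq0.
pose z t := residual (gamma t) A B (x t).
have zT t : t0 <= t -> lambda t *: Tx t = z t.
  by move=> t0t; rewrite scaler_splitting // gt_eqF // lambda_gt0.
have z_le t : t0 <= t -> `|z t| <= 2 * `|x t - xs|.
  move=> t0t; have := residual_lipschitz ip_inner A_max (g0 t t0t) (g1 t t0t) B_coco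
    (g2 t t0t) (x t) xs.
  by rewrite (residual_zer ip_inner A_max (g0 t t0t) (g1 t t0t) zs) subr0.
have z_step t s : t0 <= t -> t0 <= s -> `|z s - z t| <= 2 * `|x s - x t|
    + (2 * `|B (x t)| + (gamma t)^-1 * `|z t|) * `|gamma s - gamma t|.
  move=> t0t t0s; rewrite [X in _ <= _ + X]mulrC.
  exact: (residual_step ip_inner A_max (g0 s t0s) (g1 s t0s) B_coco (g2 s t0s)
    (x s) (x t) (g0 t t0t) (g1 t t0t)).
have Lambda_gt0 t : t0 <= t -> 0 < Lambda t.
  by move=> t0t; have [k k0 hk] := ereal_inf_gt0P inf_Lambda; apply: lt_le_trans (hk t t0t).
have coco t : t0 <= t -> Lambda t * `|Tx t| ^+ 2 <= ip (x t - xs) (Tx t).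
  move=> t0t; have l0 := lambda_gt0 t t0t.
  have := residual_cocoercive ip_inner A_max (g0 t t0t) (g1 t t0t) B_coco (g2 t t0t) (x t) zs.
  rewrite -/(z t) -zT // normrZ exprMn (ipZr ip_inner) (gtr0_norm l0) => h.
  rewrite -(ler_pM2l l0); apply: le_trans h; rewrite le_eqVlt; apply/orP; left; apply/eqP.
  by rewrite /Lambda /coef_Lambda; ring.
have lambda_d := lambda_C1.1; have gamma_d := gamma_C1.1.
have hD f : differentiable_from t0 f -> forall t, t0 <= t ->
    has_deriv_from t0 f t (deriv_from t0 f t).
  by move=> fd t /fd /derivable_fromP.
have beta_d : differentiable_from t0 beta.
  move=> t t0t; have hth := hD _ _ theta_C1.1 t t0t; have hph := hD _ _ phi_C1.1 t t0t.
  have hps := hD _ _ psi_C1.1 t t0t; have h1 := has_deriv_cst t0 (1 : R) t.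
  have hG := has_derivB h1
    (has_derivD (has_derivM hth hph) (has_derivM (has_derivB h1 hth) hps)).
  have G0 : 1 - (theta t * phi t + (1 - theta t) * psi t) != 0.
    by rewrite gt_eqF // subr_gt0 Gamma_lt1.
  exact: has_deriv_derivable (has_derivM (has_derivM (hD _ _ lambda_d t t0t) hth)
    (has_derivV (f := fun s => 1 - Gamma s) G0 hG)).
(* Unfolded, beta would be torn apart by the sign lemmas for products. *)
clearbody alpha beta b Lambda.
have x_tame : tame t0 x by exact: tame_deriv.
have dx_tame : tame t0 dx by exact: tame_ac.
have z_tame : tame t0 z.
  apply: tame_lipschitz => t t0t.
  have [K [d d0 hK]] := point_lipschitz_deriv (x_d t t0t).
  have [K' [d' d'0 hK']] := point_lipschitz_deriv (gamma_d t t0t).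
  set M := 2 * `|B (x t)| + (gamma t)^-1 * `|z t|.
  have M0 : 0 <= M by rewrite addr_ge0 ?mulr_ge0 ?invr_ge0 ?(ltW (g0 t t0t)).
  exists (2 * K + M * K'), (Num.min d d') => [|s t0s]; first by rewrite lt_min d0.
  rewrite lt_min => /andP[sd sd']; apply: le_trans (z_step t s t0t t0s) _; rewrite -/M.
  have := hK s t0s sd; have := ler_wpM2l M0 (hK' s t0s sd'); clear; lra.
have Tx_tame : tame t0 Tx.
  apply: (@tameZ _ _ _ (fun t => (lambda t)^-1) z) => //; apply: tame_deriv => t t0t.
  have l0 : lambda t != 0 by rewrite gt_eqF // lambda_gt0.
  exact: has_deriv_derivable (has_derivV (f := lambda) l0 (hD _ _ lambda_d t t0t)).

(* Decrease of the energy *)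
pose v t := dx t + beta t *: Tx t.
pose u t := a t *: (x t - xs) + m t *: v t.
pose E t := 2^-1 *: `|u t| ^+ 2 + 2^-1 *: (c t *: `|x t - xs| ^+ 2).
have E_tame : tame t0 E.
  have y_tame : tame t0 (fun t => x t - xs) by apply: tameB => //; exact: tame_cst.
  have u_tame : tame t0 u.
    apply: tameD; apply: tameZ => //; try exact: tame_deriv.
    by apply: tameD => //; apply: tameZ => //; exact: tame_deriv.
  apply: tameD; apply: tame_scale; first exact: tame_normsq.
  by apply: tameZ; [exact: tame_deriv | exact: tame_normsq].
have E_ae : ae_from t0 (fun t => exists2 l, has_deriv_from t0 E t l &
    l <= - (2^-1 * Wv t * `|v t| ^+ 2 + WT t * `|Tx t| ^+ 2)).
  apply: ae_fromS (ae_fromI (ae_fromI ode param_eq) (ae_fromI W_gt0 param_le)) => // t t0t.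
  move=> [[[dx_t Tx_t ode_t] eq_t] [[Wv_t WT_t] le_t]].
  apply: (@energy_dissipation _ _ _ ip_inner t0 t Lambda alpha beta b a m c x Tx xs) => //.
  - exact: x_d.
  - exact: beta_d.
  - exact: a_diff.
  - exact: m_diff.
  - exact: c_diff.
  - exact: Lambda_gt0.
  - exact: coco.
have W_ge0 t : t0 <= t -> 0 < Wv t /\ 0 < WT t ->
    0 <= 2^-1 * Wv t * `|v t| ^+ 2 + WT t * `|Tx t| ^+ 2.
  by move=> _ [Wv0 WT0]; rewrite addr_ge0 // mulr_ge0 ?exprn_ge0 // ltW // mulr_gt0.
have E_mono : forall p q, t0 <= p -> p <= q -> E q <= E p.
  apply: nonincreasing_tame => //; apply: ae_fromS (ae_fromI E_ae W_gt0) => // t t0t.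
  move=> [[l hl lE] W0]; exists l => //; apply: le_trans lE _.
  by rewrite oppr_le0 W_ge0.
have E_ge0 t : t0 <= t -> 0 <= E t.
  move=> t0t; have c0 := ltW (c_gt0 t t0t).
  by rewrite addr_ge0 // mulr_ge0 ?invr_ge0 ?mulr_ge0 ?exprn_ge0.
(* A bound without square roots, from [2 r <= r^2 + 1]. *)
have sqr_bound (r K : R) : r ^+ 2 <= K -> r <= K + 1.
  by move=> h; have := sqr_ge0 (r - 1); have := sqr_ge0 r; move: h; clear; lra.

(* Boundedness of the trajectory, the residual and [m x'] *)
have [k k0 hk] := ereal_inf_gt0P inf_c.
have [Cy Cy0 y_le] : exists2 C, 0 <= C & forall t, t0 <= t -> `|x t - xs| <= C.
  have E00 := E_ge0 t0 (lexx _).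
  exists (2 * E t0 / k + 1) => [|t t0t].
    by rewrite addr_ge0 ?divr_ge0 ?mulr_ge0 // ltW.
  apply: sqr_bound; rewrite ler_pdivlMr //.
  have := E_mono t0 t (lexx _) t0t; rewrite {1}/E /GRing.scale /=.
  have := ler_wpM2r (exprn_ge0 2 (normr_ge0 (x t - xs))) (hk t t0t).
  have : 0 <= `|u t| ^+ 2 by rewrite exprn_ge0.
  by clear; lra.
have [Cu Cu0 u_le] : exists2 C, 0 <= C & forall t, t0 <= t -> `|u t| <= C.
  have E00 := E_ge0 t0 (lexx _).
  exists (2 * E t0 + 1) => [|t t0t]; first by rewrite addr_ge0 ?mulr_ge0.
  apply: sqr_bound.
  have := E_mono t0 t (lexx _) t0t; rewrite {1}/E /GRing.scale /=.
  have : 0 <= c t * `|x t - xs| ^+ 2 by rewrite mulr_ge0 ?exprn_ge0 // ltW // c_gt0.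
  by clear; lra.
have z_bound t : t0 <= t -> `|z t| <= 2 * Cy.
  by move=> t0t; apply: le_trans (z_le t t0t) _; rewrite ler_pM2l // y_le.
(* [gmin B] is the identity minus the forward step of length [gmin], both nonexpansive; whence the
   factor 2. *)
have B_bound t : t0 <= t -> `|B (x t)| <= `|B xs| + 2 * Cy / gmin.
  move=> t0t; have /andP[gl gr] := gamma_bnd t t0t.
  have gm2 : gmin <= 2 * nu := ltW (le_lt_trans (le_trans gl gr) gmax_lt).
  have := forward_nonexpansive ip_inner gmin0 B_coco gm2 (x t) xs => h.
  have e1 : gmin *: (B (x t) - B xs)
      = (x t - xs) - (forward gmin B (x t) - forward gmin B xs).
    by rewrite forwardB subKr.
  have h3 : gmin * `|B (x t) - B xs| <= 2 * Cy.
    rewrite -{1}(gtr0_norm gmin0) -normrZ e1; apply: le_trans (ler_normB _ _) _.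
    by have := y_le t t0t; move: h; clear; lra.
  rewrite -[B (x t)](subrK (B xs)) addrC; apply: le_trans (ler_normD _ _) _.
  by rewrite lerD2l ler_pdivlMr // mulrC.
have part1 : hyp1 -> exists2 C, 0 < C & forall t, t0 <= t ->
    [/\ `|z t| <= C, m t * `|dx t| <= C & m t * beta t / lambda t <= C].
  move=> [/ereal_sup_ltyP[Ma hMa] /ereal_sup_ltyP[Mb hMb]].
  have Mb0 : 0 <= Mb.
    apply: le_trans (hMb t0 (lexx _)).
    have h1 := ltW (m_gt0 t0 (lexx _)); have h2 := ltW (beta_gt0 t0 (lexx _)).
    by have h3 := ltW (lambda_gt0 t0 (lexx _)); rewrite divr_ge0 ?mulr_ge0.
  have Ma0 : 0 <= Ma by apply: le_trans (hMa t0 (lexx _)); rewrite ltW // a_gt0.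
  have MaCy := mulr_ge0 Ma0 Cy0; have MbCy := mulr_ge0 Mb0 Cy0.
  exists (2 * Cy + Cu + Ma * Cy + Mb * (2 * Cy) + Mb + 1).
    by move: Cy0 Cu0 MaCy MbCy Mb0; clear; lra.
  move=> t t0t; have m0 := m_gt0 t t0t; have l0 := lambda_gt0 t t0t.
  split; last by have := hMb t t0t; move: Cy0 Cu0 MaCy MbCy; clear; lra.
    by have := z_bound t t0t; move: Cu0 MaCy MbCy Mb0; clear; lra.
  rewrite -{1}(gtr0_norm m0) -normrZ.
  (* Writing [beta T] through [z] is where the bound on [m beta / lambda] is spent. *)
  have -> : m t *: dx t = u t - a t *: (x t - xs) - (m t * beta t / lambda t) *: z t.
    rewrite -zT // scalerA divfK ?gt_eqF // /u /v [a t *: _ + _]addrC addrK.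
    by rewrite scalerDr scalerA addrK.
  apply: le_trans (ler_normB _ _) _; rewrite normrZ.
  have h1 : `|u t - a t *: (x t - xs)| <= Cu + Ma * Cy.
    apply: le_trans (ler_normB _ _) _; rewrite normrZ (gtr0_norm (a_gt0 t t0t)).
    by rewrite lerD ?u_le // ler_pM ?y_le ?hMa // ltW // a_gt0.
  have h2 : `|m t * beta t / lambda t| * `|z t| <= Mb * (2 * Cy).
    have r0 : 0 < m t * beta t / lambda t by rewrite divr_gt0 // mulr_gt0 // beta_gt0.
    by rewrite gtr0_norm // ler_pM ?(ltW r0) ?z_bound ?hMb.
  by move: h1 h2 Cy0 Mb0; clear; lra.
have dm_pos : hyp2 -> exists2 m1, 0 < m1 & forall t, t0 <= t -> m1 <= dm t.
  by move=> [[m1 [m2 [m10 hm]]] _ _ _ _]; exists m1 => // t /hm/andP[].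

(* Derivatives of the residual and of [T] *)
have part2 : hyp1 -> hyp2 -> exists2 C, 0 < C & exists2 t1, t0 <= t1 &
    forall t, t1 <= t -> derivable_from t0 Tx t ->
    `|deriv_from t0 Tx t| <= C * (dm t / (m t * lambda t)) /\
    exists2 l, has_deriv_from t0 z t l & `|l| <= C * (dm t / m t).
  move=> /part1[C C0 hC] h2; have [m1 m10 hm] := dm_pos h2.
  case: h2 => _ _ _ /eqO_boundP[K1 K10 hK1] /eqO_boundP[K2 K20 hK2].
  have [t1 t01 ht1] := pinfty_from t0 (filterI hK1 hK2).
  have gmax0 : 0 < gmax.
    have /andP[h1 h2] := gamma_bnd t0 (lexx _).
    exact: lt_le_trans gmin0 (le_trans h1 h2).
  set CB := `|B xs| + 2 * Cy / gmin in B_bound.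
  have CB0 : 0 <= CB by rewrite addr_ge0 // divr_ge0 ?mulr_ge0 // ltW.
  (* The first summand comes from [|x'| <= C / m <= (C / m1) (dm / m)], the second from
     [|gamma'| <= K1 (dm / m) gamma] times the last factor in [z_step]. *)
  pose C1 := 2 * (C / m1) + (2 * CB * gmax + C) * K1.
  have C10 : 0 < C1.
    rewrite ltr_pwDl ?mulr_gt0 ?invr_gt0 // mulr_ge0 ?(ltW K10) // addr_ge0 ?(ltW C0) //.
    by rewrite mulr_ge0 ?mulr_ge0 // ltW.
  have K2C : 0 < K2 * C by rewrite mulr_gt0.
  exists (C1 + K2 * C); first by rewrite addr_gt0.
  exists t1 => // t t1t Tx_t; have t0t := le_trans t01 t1t.
  have m0 := m_gt0 t t0t; have l0 := lambda_gt0 t t0t; have gt0 := g0 t t0t.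
  have dm0 : 0 < dm t by apply: lt_le_trans (hm t t0t).
  have [zC dxC _] := hC t t0t; have [] := ht1 t t1t.
  set r := dm t / m t; have r0 : 0 < r by rewrite divr_gt0.
  rewrite (gtr0_norm r0) !normrM !normr_id !normfV (gtr0_norm gt0) (gtr0_norm l0).
  rewrite !ler_pdivrMr // => hg hl.
  have dx_r : `|dx t| <= C / m1 * r.
    rewrite -(ler_pM2l m0); apply: le_trans dxC _.
    rewrite (_ : m t * (C / m1 * r) = C * (dm t / m1)); last first.
      by rewrite /r; field; rewrite !gt_eqF.
    by rewrite ler_peMr ?(ltW C0) // ler_pdivlMr // mul1r hm.
  have hz : has_deriv_from t0 z t (lambda t *: deriv_from t0 Tx t + dlambda t *: Tx t).
    apply: (has_deriv_eq zT t0t).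
    exact: has_derivZ (hD _ _ lambda_d t t0t) (derivable_fromP Tx_t).
  have hz_le : `|lambda t *: deriv_from t0 Tx t + dlambda t *: Tx t| <= C1 * r.
    apply: le_trans (has_deriv_norm_le t0t hz (hD _ _ x_d t t0t) (hD _ _ gamma_d t t0t)
      (fun s => z_step t s t0t)) _.
    rewrite -/(dx t) -/(dgamma t).
    have gV : (gamma t)^-1 * gamma t = 1 by rewrite mulVf // gt_eqF.
    have h1 : (2 * `|B (x t)| + (gamma t)^-1 * `|z t|) * `|dgamma t|
        <= (2 * `|B (x t)| + (gamma t)^-1 * `|z t|) * (K1 * r * gamma t).
      by apply: ler_wpM2l => //; rewrite addr_ge0 ?mulr_ge0 // invr_ge0 ltW.
    have h2 : (2 * `|B (x t)| + (gamma t)^-1 * `|z t|) * (K1 * r * gamma t)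
        = (2 * `|B (x t)| * gamma t + `|z t|) * (K1 * r).
      by field; rewrite gt_eqF.
    have h3 : `|B (x t)| * gamma t <= CB * gmax.
      by rewrite ler_pM ?B_bound // ?(ltW gt0) //; have /andP[] := gamma_bnd t t0t.
    have h4 : (2 * `|B (x t)| * gamma t + `|z t|) * (K1 * r)
        <= (2 * CB * gmax + C) * (K1 * r).
      apply: ler_wpM2r; first exact/ltW/mulr_gt0.
      by apply: lerD => //; rewrite -!mulrA ler_pM2l.
    by move: dx_r h1 h4; rewrite h2 /C1; clear; lra.
  split; last first.
    exists (lambda t *: deriv_from t0 Tx t + dlambda t *: Tx t) => //.
    by have := mulr_gt0 K2C r0; move: hz_le; clear; lra.
  rewrite -(ler_pM2l l0) [leRHS](_ : _ = (C1 + K2 * C) * r); last first.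
    by rewrite /r; field; rewrite !gt_eqF.
  rewrite -{1}(gtr0_norm l0) -normrZ.
  (* [lambda T' = z' - lambda' T], and the last term accounts for [K2 * C]. *)
  rewrite -[lambda t *: _](addrK (dlambda t *: Tx t)); apply: le_trans (ler_normB _ _) _.
  have h5 : `|dlambda t *: Tx t| <= K2 * r * C.
    rewrite normrZ; apply: le_trans (ler_wpM2r (normr_ge0 _) hl) _.
    have h6 : lambda t * `|Tx t| <= C by rewrite -{1}(gtr0_norm l0) -normrZ zT.
    by have := ler_wpM2l (ltW (mulr_gt0 K20 r0)) h6; clear; lra.
  by move: hz_le h5; clear; lra.
have near_t0 : \forall t \near +oo, t0 <= t by apply: nbhs_pinfty_ge; exact: num_real.
split.
  move=> /part1[C C0 hC]; split; apply: (@eqO_bound _ _ _ _ _ _ _ C);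
    apply: filterS near_t0 => t t0t; have [zC dxC _] := hC t t0t.
  - have l0 := lambda_gt0 t t0t.
    rewrite normr_id gtr0_norm ?invr_gt0 // ler_pdivlMr // mulrC.
    by rewrite -[X in X * _](gtr0_norm l0) -normrZ zT.
  - have m0 := m_gt0 t t0t.
    by rewrite normr_id gtr0_norm ?invr_gt0 // ler_pdivlMr // mulrC.
split.
  move=> h1 h2; have [C C0 [t1 t01 hC]] := part2 h1 h2; split.
    by exists t0; apply: ae_fromS ode => // t _ [].
  apply: (@eqO_bound _ _ _ _ _ _ _ C); exists t1.
  apply: ae_fromS ode => // t t1t [_ Tx_t _]; have [h _] := hC t t1t Tx_t.
  rewrite normr_id; apply: le_trans h _.
  by rewrite ler_pM2l // ler_norm.

(* Bound on the acceleration *)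
move=> h1 h2 [Cb [Cl [Cv [CT [[_ Cl0 Cv0 _] hO hl hW]]]]].
move=> /limf_einf_gt0P[e e0 he].
case: hO => /eqO_boundP[Ka Ka0 ha] /eqO_boundP[Kb Kb0 hb] /eqO_boundP[Kc Kc0 hc] _.
have [C C0 hC] := part1 h1; have [m1 m10 hm] := dm_pos h2.
have [C2 C20 [t1 t01 hT]] := part2 h1 h2.
have [t2 t12 ht2] := pinfty_from t1 (filterI (filterI ha hb) (filterI hc he)).
have t02 := le_trans t01 t12.
have dm_gt0 t : t0 <= t -> 0 < dm t by move=> t0t; apply: lt_le_trans (hm t t0t).
(* [1 / lambda <= 1 / (Cl m^2)], and inserting the factor [dm >= m1] costs [1 / m1]. *)
pose K := (Cl * m1)^-1; have K0 : 0 < K by rewrite invr_gt0 mulr_gt0.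
have lambda_V t : t0 <= t -> (lambda t)^-1 <= K * (dm t / m t ^+ 2).
  move=> t0t; have m0 := m_gt0 t t0t; have l0 := lambda_gt0 t t0t.
  rewrite -[leLHS]mul1r ler_pdivrMr // /K -(ler_pM2l (mulr_gt0 Cl0 m10)) mulr1.
  rewrite [leRHS](_ : _ = dm t / m t ^+ 2 * lambda t); last first.
    by field; rewrite !gt_eqF // mulr_gt0.
  have s0 : 0 <= dm t / m t ^+ 2 by rewrite divr_ge0 ?exprn_ge0 // ltW // dm_gt0.
  apply: le_trans (ler_wpM2l s0 (hl t t0t)).
  rewrite [leRHS](_ : _ = Cl * dm t); last by field; rewrite gt_eqF.
  by rewrite ler_pM2l // hm.
pose sol t := [/\ derivable_from t0 dx t, derivable_from t0 Tx t
  & deriv_from t0 dx t + alpha t *: dx t + beta t *: deriv_from t0 Tx t + b t *: Tx t = 0].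
have Tx_le t : t0 <= t -> `|Tx t| <= C * (lambda t)^-1.
  move=> t0t; have l0 := lambda_gt0 t t0t; have [zC _ _] := hC t t0t.
  by rewrite ler_pdivlMr // mulrC -(gtr0_norm l0) -normrZ zT.
(* One summand for each term of the equation solved for [x'']; the last two use [lambda_V]. *)
pose C3 := Ka * C + Kb * C2 * K + Kc * C * K.
have C30 : 0 < C3 by rewrite /C3 !addr_gt0 ?mulr_gt0.
have ddx_le t : t2 <= t -> sol t -> `|deriv_from t0 dx t| <= C3 * (dm t / m t ^+ 2).
  move=> t2t [dx_t Tx_t ode_t]; have t0t := le_trans t02 t2t.
  have m0 := m_gt0 t t0t; have l0 := lambda_gt0 t t0t; have dm0 := dm_gt0 t t0t.
  have [[hA hB] [hCc _]] := ht2 t t2t; have [_ dxC _] := hC t t0t.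
  have [dT _] := hT t (le_trans t12 t2t) Tx_t.
  have -> : deriv_from t0 dx t
      = - (alpha t *: dx t + beta t *: deriv_from t0 Tx t + b t *: Tx t).
    by apply/eqP; rewrite -addr_eq0 !addrA ode_t.
  rewrite normrN; apply: le_trans (ler_normD _ _) _.
  have s0 : 0 < dm t / m t ^+ 2 by rewrite divr_gt0 // exprn_gt0.
  have lV := lambda_V t t0t.
  have i1 : `|alpha t *: dx t| <= Ka * C * (dm t / m t ^+ 2).
    rewrite normrZ; have dxC' : `|dx t| <= C / m t by rewrite ler_pdivlMr // mulrC.
    apply: le_trans (ler_pM _ _ hA dxC') _ => //.
    rewrite gtr0_norm ?divr_gt0 // le_eqVlt; apply/orP; left; apply/eqP.
    by field; rewrite gt_eqF.
  have i2 : `|beta t *: deriv_from t0 Tx t| <= Kb * C2 * K * (dm t / m t ^+ 2).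
    rewrite normrZ; apply: le_trans (ler_pM _ _ hB dT) _ => //.
    rewrite gtr0_norm ?divr_gt0 //.
    rewrite [leLHS](_ : _ = Kb * C2 * (lambda t)^-1); last by field; rewrite !gt_eqF.
    by rewrite -(mulrA (Kb * C2)) ler_pM2l // mulr_gt0.
  have i3 : `|b t *: Tx t| <= Kc * C * K * (dm t / m t ^+ 2).
    rewrite normrZ; apply: le_trans (ler_pM _ _ hCc (Tx_le t t0t)) _ => //.
    rewrite normr1 mulr1 mulrA -(mulrA (Kc * C)) ler_pM2l // mulr_gt0 //.
  have := ler_normD (alpha t *: dx t) (beta t *: deriv_from t0 Tx t).
  by move: i1 i2 i3; rewrite /C3; clear; lra.

(* Convergence to zero in the time [ln m] *)
pose L t := ln (m t).
have hL t : t0 <= t -> has_deriv_from t0 L t (dm t / m t).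
  by move=> t0t; apply: has_deriv_ln; [exact: m_gt0 | exact: (hD _ _ m_diff)].
have L_tame : tame t0 L.
  by apply: tame_deriv => t t0t; exact: has_deriv_derivable (hL t t0t).
(* At least linear growth of [m] makes the time [L] run to infinity. *)
have m_ge t : t0 <= t -> m1 * (t - t0) <= m t.
  move=> t0t; pose f s := m1 *: (s : R) - m s.
  have fd s : t0 <= s -> has_deriv_from t0 f s (m1 *: 1 - dm s).
    by move=> t0s; apply: has_derivB (hD _ _ m_diff s t0s); apply/has_deriv_scale/has_deriv_id.
  have : f t <= f t0.
    apply: (@nonincreasing_tame _ t0 f t0) => //.
      by apply: tame_deriv => s t0s; exact: has_deriv_derivable (fd s t0s).
    apply: ae_from_near => s t0s; exists (m1 *: 1 - dm s); last exact: fd.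
    by have := hm s t0s; rewrite /GRing.scale /= mulr1; clear; lra.
  by have := m_gt0 t0 (lexx _); rewrite /f /GRing.scale /=; clear; lra.
have Loo : L t @[t --> +oo] --> +oo.
  apply/cvgryPge => M; apply: filterS (filterI near_t0 (nbhs_pinfty_ge (num_real
    (t0 + expR M / m1)))) => t [t0t tM].
  rewrite -[M]expRK ler_ln ?posrE ?expR_gt0 ?m_gt0 //; apply: le_trans (m_ge t t0t).
  by rewrite mulrC -ler_pdivrMr //; move: tM; clear; lra.
have sol_ae : ae_from t2 (fun t => sol t /\ (exists2 l, has_deriv_from t0 E t l &
    l <= - (2^-1 * Wv t * `|v t| ^+ 2 + WT t * `|Tx t| ^+ 2)) /\ (0 < Wv t /\ 0 < WT t)).
  by apply: ae_fromS (ae_fromI ode (ae_fromI E_ae W_gt0)).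
have dm_m t : t0 <= t -> 0 <= dm t / m t.
  by move=> t0t; rewrite divr_ge0 // ltW ?dm_gt0 ?m_gt0.
(* In the time [L], of speed [dm / m], this is a dissipation of [e |z|^2]; the weight of [WT] in the
   lower limit hypothesis is the one that produces it. *)
have WT_ge t : t2 <= t -> e * (dm t / m t) * `|z t| ^+ 2 <= WT t * `|Tx t| ^+ 2.
  move=> t2t; have t0t := le_trans t02 t2t; have [_ [_ he_t]] := ht2 t t2t.
  have m0 := m_gt0 t t0t; have l0 := lambda_gt0 t t0t; have dm0 := dm_gt0 t t0t.
  rewrite -zT // normrZ exprMn mulrA ler_wpM2r ?exprn_ge0 // (gtr0_norm l0).
  move: he_t; rewrite ler_pdivlMr ?mulr_gt0 ?exprn_gt0 // => he_t.
  rewrite [leLHS](_ : _ = e * (dm t * lambda t ^+ 2) / m t); last first.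
    by field; rewrite gt_eqF.
  by rewrite ler_pdivrMr // (mulrC (WT t)).
have z_cvg : `|z t| ^+ 2 @[t --> +oo] --> (0 : R).
  (* [2 * C * C2] is a Lipschitz constant of [|z|^2] in the time [L], from [2 <z, z'>] with
     [|z| <= C] and [|z'| <= C2 (dm / m)]. *)
  apply: (@barbalat _ t0 L E _ t2 (2 * C * C2) e) => //.
  - by rewrite !mulr_gt0.
  - exact: tame_normsq.
  - by move=> t t2t; apply: E_ge0; exact: le_trans t2t.
  apply: ae_fromS sol_ae => // t t2t [[_ Tx_t _] [[lE hE hlE] [Wv0 _]]].
  have t0t := le_trans t02 t2t; have r0 := dm_m t t0t.
  have [_ [lz hz lz_le]] := hT t (le_trans t12 t2t) Tx_t.
  exists (dm t / m t), lE, (2 * ip (z t) lz); split; split => //.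
  - exact: hL.
  - apply: le_trans hlE _; rewrite lerN2.
    have := WT_ge t t2t; have : 0 <= 2^-1 * Wv t * `|v t| ^+ 2.
      by rewrite mulr_ge0 ?exprn_ge0 // mulr_ge0 ?invr_ge0 // ltW.
    by clear; lra.
  - exact: has_deriv_normsq.
  have := ip_ge_normN ip_inner (z t) lz; have [zC _ _] := hC t t0t.
  have := ler_pM (normr_ge0 _) (normr_ge0 _) zC lz_le.
  by clear; lra.
have w_cvg : `|m t *: dx t| ^+ 2 @[t --> +oo] --> (0 : R).
  (* Since [m x' = m v - (m beta / lambda) z], one has [|m x'|^2 <= 2 |m v|^2 + 2 C^2 |z|^2]. The
     first entry fits the first term into half of [Wv |v|^2], the second fits the other one into
     [WT |T|^2]. *)
  pose k' := Num.min (Cv / 4) (e / (2 * C ^+ 2)).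
  have k'0 : 0 < k' by rewrite lt_min !divr_gt0 ?mulr_gt0 ?exprn_gt0.
  apply: (@barbalat _ t0 L E _ t2 (2 * C * (C3 + C)) k') => //.
  - by rewrite !mulr_gt0 // addr_gt0.
  - by apply: tame_normsq; apply: tameZ => //; exact: tame_deriv.
  - by move=> t t2t; apply: E_ge0; exact: le_trans t2t.
  apply: ae_fromS sol_ae => // t t2t [sol_t [[lE hE hlE] [Wv0 _]]].
  have t0t := le_trans t02 t2t; have r0 := dm_m t t0t.
  have m0 := m_gt0 t t0t; have l0 := lambda_gt0 t t0t; have dm0 := dm_gt0 t t0t.
  have [zC dxC mb] := hC t t0t; have ddxC := ddx_le t t2t sol_t.
  have [dx_t _ _] := sol_t.
  exists (dm t / m t), lE, (2 * ip (m t *: dx t) (m t *: deriv_from t0 dx t + dm t *: dx t)).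
  split; split => //.
  - exact: hL.
  - apply: le_trans hlE _; rewrite lerN2; have h_z := WT_ge t t2t; have [hWv _] := hW t t0t.
    have k'1 : k' <= Cv / 4 by rewrite ge_min lexx.
    have k'2 : k' * (2 * C ^+ 2) <= e.
      by rewrite -ler_pdivlMr ?mulr_gt0 ?exprn_gt0 // ge_min lexx orbT.
    have wE : m t *: dx t = m t *: v t - (m t * beta t / lambda t) *: z t.
      by rewrite -zT // scalerA divfK ?gt_eqF // /v scalerDr scalerA addrK.
    have q0 : 0 <= m t * beta t / lambda t.
      by rewrite divr_ge0 ?(ltW l0) // mulr_ge0 ?(ltW m0) // ltW // beta_gt0.
    have n1 : `|m t *: dx t| <= m t * `|v t| + C * `|z t|.
      rewrite wE; apply: le_trans (ler_normB _ _) _.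
      rewrite (normrZ (m t)) (normrZ (_ / _)) (gtr0_norm m0) (ger0_norm q0).
      by rewrite lerD2l ler_wpM2r.
    have n2 : `|m t *: dx t| ^+ 2 <= 2 * (m t * `|v t|) ^+ 2 + 2 * C ^+ 2 * `|z t| ^+ 2.
      have : `|m t *: dx t| ^+ 2 <= (m t * `|v t| + C * `|z t|) ^+ 2.
        by rewrite ler_sqr ?nnegrE // addr_ge0 // mulr_ge0 // ltW.
      by have := sqr_ge0 (m t * `|v t| - C * `|z t|); clear; lra.
    have n3 : k' * (2 * (m t * `|v t|) ^+ 2) * (dm t / m t) <= 2^-1 * Wv t * `|v t| ^+ 2.
      have h4 := ler_wpM2r (exprn_ge0 2 (normr_ge0 (v t))) hWv.
      have h5 : 0 <= m t * dm t * `|v t| ^+ 2 by rewrite !mulr_ge0 ?exprn_ge0 // ltW.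
      rewrite [leLHS](_ : _ = 2 * k' * (m t * dm t * `|v t| ^+ 2)); last first.
        by field; rewrite gt_eqF.
      by have := ler_wpM2r h5 k'1; move: h4; clear; lra.
    have n4 : k' * (2 * C ^+ 2 * `|z t| ^+ 2) * (dm t / m t) <= WT t * `|Tx t| ^+ 2.
      apply: le_trans h_z.
      have h5 : 0 <= dm t / m t * `|z t| ^+ 2 by rewrite mulr_ge0 ?exprn_ge0.
      by have := ler_wpM2r h5 k'2; clear; lra.
    have := ler_wpM2r r0 (ler_wpM2l (ltW k'0) n2); move: n3 n4; clear; lra.
  - apply: has_deriv_normsq => //.
    exact: has_derivZ (hD _ _ m_diff t t0t) (derivable_fromP dx_t).
  have dw : `|m t *: deriv_from t0 dx t + dm t *: dx t| <= (C3 + C) * (dm t / m t).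
    apply: le_trans (ler_normD _ _) _; rewrite !normrZ (gtr0_norm m0) (gtr0_norm dm0) mulrDl.
    apply: lerD.
      apply: le_trans (ler_wpM2l (ltW m0) ddxC) _; rewrite le_eqVlt; apply/orP; left.
      by apply/eqP; field; rewrite gt_eqF.
    rewrite mulrA ler_pdivlMr // -mulrA (mulrC (dm t)) ler_pM2r // mulrC.
    by have := dxC; clear; lra.
  have w_le : `|m t *: dx t| <= C by rewrite normrZ gtr0_norm.
  have := ip_ge_normN ip_inner (m t *: dx t) (m t *: deriv_from t0 dx t + dm t *: dx t).
  have := ler_pM (normr_ge0 _) (normr_ge0 _) w_le dw.
  by clear; lra.

(* Landau estimates and the Yosida term *)
have z_small eps : 0 < eps -> \forall t \near +oo, `|z t| <= eps.
  exact: sqr_norm_cvg0.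
have YxE t : t0 <= t -> (lambda t / gamma t) *: Tx t = Yx t.
  by move=> t0t; apply/esym/yosida_splitting; rewrite gt_eqF ?lambda_gt0 ?g0.
(* The derivative of [lambda / gamma], kept explicit until [lg'E] expresses its size through the
   derivative of [gamma / lambda]. *)
pose lg' t := lambda t * (- (gamma t) ^- 2 * dgamma t) + dlambda t * (gamma t)^-1.
have hYx t : t0 <= t -> derivable_from t0 Tx t -> has_deriv_from t0 Yx t
    ((lambda t / gamma t) *: deriv_from t0 Tx t + lg' t *: Tx t).
  move=> t0t Tx_t; apply: (has_deriv_eq YxE t0t); apply: has_derivZ (derivable_fromP Tx_t).
  apply: has_derivM; first exact: (hD _ _ lambda_d).
  by apply: has_derivV; [rewrite gt_eqF // g0 | exact: (hD _ _ gamma_d)].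
have lg'E t : t0 <= t -> `|lg' t|
    = (lambda t / gamma t) ^+ 2 * `|deriv_from t0 (fun s => gamma s / lambda s) t|.
  move=> t0t; have l0 : lambda t != 0 by rewrite gt_eqF // lambda_gt0.
  have gt0 : gamma t != 0 by rewrite gt_eqF // g0.
  have hgl := has_derivM (hD _ _ gamma_d t t0t)
    (has_derivV (f := lambda) l0 (hD _ _ lambda_d t t0t)).
  rewrite (deriv_fromE t0t hgl).
  rewrite -(ger0_norm (sqr_ge0 (lambda t / gamma t))) -normrM -normrN; congr `|_|.
  by rewrite /lg' -/(dgamma t) -/(dlambda t); field; rewrite l0 gt0.
split.
- split; first by exists t0; apply: ae_fromS ode => // t _ [].
  apply: (@eqO_bound _ _ _ _ _ _ _ C3); exists t2.
  apply: ae_fromS sol_ae => // t t2t [sol_t _].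
  rewrite normr_id; apply: le_trans (ddx_le t t2t sol_t) _.
  by rewrite ler_pM2l // ler_norm.
- apply/eqoP => eps eps0; apply: filterS (filterI near_t0 (sqr_norm_cvg0 w_cvg eps0)).
  move=> t [t0t]; have m0 := m_gt0 t t0t; rewrite normrZ (gtr0_norm m0) => h.
  by rewrite normr_id gtr0_norm ?invr_gt0 // ler_pdivlMr // mulrC.
- apply/eqoP => eps eps0; apply: filterS (filterI near_t0 (z_small _ eps0)).
  move=> t [t0t]; have l0 := lambda_gt0 t t0t; rewrite -zT // normrZ (gtr0_norm l0) => h.
  by rewrite normr_id gtr0_norm ?invr_gt0 // ler_pdivlMr // mulrC.
- apply/eqoP => eps eps0; apply: filterS (filterI near_t0 (z_small _ eps0)).
  move=> t [t0t h]; have gt0 := g0 t t0t.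
  rewrite normr_id gtr0_norm ?invr_gt0 // -YxE // mulrC -scalerA zT // normrZ.
  by rewrite gtr0_norm ?invr_gt0 // mulrC ler_pM2r ?invr_gt0.
split.
  exists t0; apply: ae_fromS ode => // t t0t [_ Tx_t _].
  exact: has_deriv_derivable (hYx t t0t Tx_t).
pose n t := `|deriv_from t0 Yx t|.
pose q t := `|lg' t *: Tx t|.
(* Capping the part of Yx' coming from (lambda / gamma)' T at |Yx'| makes the
   remainder nonnegative and at most |(lambda / gamma) T'|. *)
exists (fun t => n t - Num.min (q t) (n t)), (fun t => Num.min (q t) (n t)); split.
- apply: (@eqO_bound _ _ _ _ _ _ _ C2); exists t2.
  apply: ae_fromS sol_ae => // t t2t [[_ Tx_t _] _].
  have t0t := le_trans t02 t2t; have l0 := lambda_gt0 t t0t; have gt0 := g0 t t0t.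
  have [dT _] := hT t (le_trans t12 t2t) Tx_t; have r0 := dm_m t t0t.
  have h : n t <= `|(lambda t / gamma t) *: deriv_from t0 Tx t| + q t.
    by have := deriv_fromE t0t (hYx t t0t Tx_t); rewrite /n => ->; exact: ler_normD.
  have h' : `|(lambda t / gamma t) *: deriv_from t0 Tx t|
      <= C2 * (dm t / (m t * gamma t)).
    have lg0 : 0 < lambda t / gamma t by rewrite divr_gt0.
    rewrite normrZ (gtr0_norm lg0); apply: le_trans (ler_wpM2l (ltW lg0) dT) _.
    rewrite le_eqVlt; apply/orP; left; apply/eqP.
    by field; rewrite !gt_eqF // m_gt0.
  have s0 : 0 <= dm t / (m t * gamma t).
    by rewrite invfM mulrA mulr_ge0 // invr_ge0 ltW.
  rewrite (ger0_norm s0) ger0_norm ?subr_ge0 ?ge_min ?lexx ?orbT //.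
  apply: le_trans h'; rewrite lerBlDr; case: (leP (q t) (n t)) => _ //.
  by rewrite lerDr.
- apply/eqoP => eps eps0; apply: ae_pinfty_near.
  apply: filterS (filterI near_t0 (z_small _ eps0)) => t [t0t h].
  have l0 := lambda_gt0 t t0t; have gt0 := g0 t t0t.
  have q0 : 0 <= q t by exact: normr_ge0.
  rewrite ger0_norm ?le_min ?q0 ?normr_ge0 //; apply: (@le_trans _ _ (q t)).
    by rewrite ge_min lexx.
  set D := `|deriv_from t0 _ t|; have D0 : 0 <= D by exact: normr_ge0.
  (* Substituting [T = z / lambda] lowers the power of [lambda] by one and leaves the stated weight
     times [|z|], which tends to 0. *)
  have -> : q t = lambda t * D / gamma t ^+ 2 * `|z t|.
    rewrite /q normrZ lg'E // -/D -zT // (normrZ (lambda t)) (gtr0_norm l0).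
    by field; rewrite gt_eqF.
  rewrite ger0_norm; last by rewrite divr_ge0 ?exprn_ge0 ?mulr_ge0 ?(ltW l0) ?(ltW gt0).
  by rewrite [leRHS]mulrC ler_wpM2l // divr_ge0 ?exprn_ge0 ?mulr_ge0 ?(ltW l0) ?(ltW gt0).
- by exists t0; apply: ae_from_near => t _; rewrite subrK.
Qed.
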